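(* Let $\boldsymbol\lambda=(\boldsymbol\lambda_1\ge\dots\ge\boldsymbol\lambda_n)$ be a Young diagram with $\boldsymbol\lambda_n=0$ and $\boldsymbol\mu=(\boldsymbol\mu_1\ge\dots\ge\boldsymbol\mu_n)$ a weakly decreasing sequence of integers with $\boldsymbol\mu_n=-1$ and $|\boldsymbol\lambda|+|\boldsymbol\mu|=0$. Let $x_1,\dots,x_{\boldsymbol\lambda_1}\in\mathbb{C}$ and $D=\sum_{k=1}^{\boldsymbol\lambda_1}\varpi_{n-\boldsymbol\lambda^t_k}[x_k]+\mu[\infty]$, where $\boldsymbol\lambda^t_k$ is the height of the $k$-th column of $\boldsymbol\lambda$ and $\mu=-\sum_{i=1}^n\boldsymbol\mu_{n-i+1}\epsilon_i$. Put $m:=\max\{i:\boldsymbol\mu_{n-i+1}=-1\}$ and $m':=\max\{i:\boldsymbol\mu_{n-i+1}\le0\}$. Then: (a) The entries of $T_D(z)$ (for this $D$, $Z_0=1$) are: on the diagonal, $T_D(z)_{ii}=z+\sum_{r=1}^{a_{i-1}}(p_{i-1,r}+1)-\sum_{r=1}^{a_i}p_{i,r}+\sum_{x\in\mathbb{C}}\epsilon^\vee_i(\lambda_x)x$ if $i\le m$, $T_D(z)_{ii}=1$ if $m<i\le m'$, and $T_D(z)_{ii}=0$ if $i>m'$; for $m<i<j$, $T_D(z)_{ij}=0=T_D(z)_{ji}$; for $i\le m$ and $i<j$, $$T_D(z)_{ij}=-\sum_{r_i,\dots,r_{j-1}}\frac{P_{i-1}(p_{i,r_i}-1)\prod_{k=i}^{j-2}P_{k,r_k}(p_{k+1,r_{k+1}}-1)}{\prod_{k=i}^{j-1}P_{k,r_k}(p_{k,r_k})}\prod_{k=i}^{j-1}Z_k(p_{k,r_k})\,e^{\sum_{k=i}^{j-1}q_{k,r_k}},$$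 $$T_D(z)_{ji}=\sum_{r_i,\dots,r_{j-1}}\frac{P_j(p_{j-1,r_{j-1}}+1)\prod_{k=i+1}^{j-1}P_{k,r_k}(p_{k-1,r_{k-1}}+1)}{\prod_{k=i}^{j-1}P_{k,r_k}(p_{k,r_k})}\,e^{-\sum_{k=i}^{j-1}q_{k,r_k}}$$ (sums over $1\le r_k\le a_k$). (b) $T_D(z)$ is a polynomial of degree $1$ in $z$ whose coefficient of $z$ is $\sum_{i=1}^mE_{ii}$.
   Context: Let $n\ge2$, $\Lambda=\bigoplus_{j=1}^n\mathbb{Z}\epsilon_j$, $\epsilon^\vee_j$ dual basis, $\alpha_i=\epsilon_i-\epsilon_{i+1}$, $\varpi_i=-\sum_{j=i+1}^n\epsilon_j$ ($0\le i\le n-1$). For the divisor $D$ of the claim write it as $\sum_{s=1}^N\gamma_s\varpi_{i_s}[x_s]+\mu[\infty]$ with $N=\boldsymbol\lambda_1$, $i_s=n-\boldsymbol\lambda^t_s$, $\gamma_s=1$; put $\lambda=\sum_s\varpi_{i_s}$, $\lambda_x=\sum_{s:x_s=x}\varpi_{i_s}$. Then $\lambda+\mu=\sum_{i=1}^{n-1}a_i\alpha_i$ with $a_i=-\sum_{j=n-i+1}^n(\boldsymbol\lambda_j+\boldsymbol\mu_j)\in\mathbb{Z}_{\ge0}$; $a_0=a_n=0$. $\mathcal{A}$: the $\mathbb{C}$-algebra generated by $p_{i,r},e^{\pm q_{i,r}},(p_{i,r}-p_{i,s}+m)^{-1}$ ($1\le i<n$, $1\le r\ne s\le a_i$, $m\in\mathbb{Z}$)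 with $[e^{\pm q_{i,r}},p_{j,s}]=\mp\delta_{ij}\delta_{rs}e^{\pm q_{i,r}}$, $p$'s commuting, $e^q$'s commuting, $e^{\pm q_{i,r}}e^{\mp q_{i,r}}=1$. $Z_i(z)=\prod_{s:i_s=i}(z-x_s)^{\gamma_s}$, $P_j(z)=\prod_{r=1}^{a_j}(z-p_{j,r})$, $P_{j,r}(z)=\prod_{s\ne r}(z-p_{j,s})$, $P_0=P_n=1$. $T_D(z)\in\mathcal{A}((z^{-1}))\otimes\mathrm{End}\,\mathbb{C}^n$: $T_D(z)_{\alpha\beta}=\sum_{i=1}^{\min(\alpha,\beta)}f^D_{\alpha i}(z)g^D_i(z)e^D_{i\beta}(z)$, where (expanded in $z^{-1}$) $g^D_i(z)=\frac{P_i(z)}{P_{i-1}(z-1)}\prod_{k=0}^{i-1}Z_k(z)$, $e^D_{ii}=f^D_{ii}=1$ and for $i<j$: $e^D_{ij}(z)=-\sum_{r_i,\dots,r_{j-1}}\frac{P_{i-1}(p_{i,r_i}-1)\prod_{k=i}^{j-2}P_{k,r_k}(p_{k+1,r_{k+1}}-1)}{(z-p_{i,r_i})\prod_{k=i}^{j-1}P_{k,r_k}(p_{k,r_k})}\prod_{k=i}^{j-1}Z_k(p_{k,r_k})\, e^{\sum_{k=i}^{j-1}q_{k,r_k}}$, $f^D_{ji}(z)=\sum_{r_i,\dots,r_{j-1}}\frac{P_j(p_{j-1,r_{j-1}}+1)\prod_{k=i+1}^{j-1}P_{k,r_k}(p_{k-1,r_{k-1}}+1)}{(z-p_{i,r_i}-1)\prod_{k=i}^{j-1}P_{k,r_k}(p_{k,r_k})}\,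 e^{-\sum_{k=i}^{j-1}q_{k,r_k}}$. *)

(* Defs.v *)
From HB Require Import structures.
From mathcomp Require Import all_boot all_order all_algebra.
From mathcomp Require Import complex Rstruct.
Set Implicit Arguments.
Unset Strict Implicit.
Unset Printing Implicit Defensive.
Import Order.TTheory GRing.Theory Num.Theory.
Local Open Scope ring_scope.

Definition CC : fieldType := (Rdefinitions.R)[i].

(* Formal Laurent series in z^{-1} with coefficients in a (noncommutative)   *)
(* ring A, z central.  [LSer d c] stands for  \sum_{k>=0} c k * z^(d - k).   *)
Section LaurentSeries.
Variable A : pzRingType.

Record lser := LSer { ldeg : int; lcf : nat -> A }.

Definition lcoef (s : lser) (k : int) : A :=
  match ldeg s - k with Posz j => lcf s j | Negz _ => 0 end.

Definition lser_eq (s t : lser) : Prop := forall k : int, lcoef s k = lcoef t k.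

Definition lzero : lser := LSer 0 (fun _ => 0).
Definition lconst (a : A) : lser := LSer 0 (fun j => if j == 0%N then a else 0).
Definition lz : lser := LSer 1 (fun j => if j == 0%N then 1 else 0).
Definition ladd (s t : lser) : lser :=
  let d := Num.max (ldeg s) (ldeg t) in
  LSer d (fun j => lcoef s (d - j%:Z) + lcoef t (d - j%:Z)).
Definition lopp (s : lser) : lser := LSer (ldeg s) (fun j => - lcf s j).
Definition lmul (s t : lser) : lser :=
  LSer (ldeg s + ldeg t) (fun j => \sum_(i < j.+1) lcf s i * lcf t (j - i)).
(* (z - a)^{-1} = \sum_{k>=0} a^k z^{-k-1}, expanded in z^{-1} *)
Definition linvlin (a : A) : lser := LSer (-1) (fun j => a ^+ j).
Definition llin (a : A) : lser := ladd lz (lopp (lconst a)).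
End LaurentSeries.

Arguments lzero {A}.
Arguments lz {A}.

Notation "\lsum_ ( i <- r ) F" := (\big[@ladd _/lzero]_(i <- r) F)
  (at level 41, F at level 41, i, r at level 50).
Notation "\lprod_ ( i <- r ) F" := (\big[@lmul _/lconst 1]_(i <- r) F)
  (at level 36, F at level 36, i, r at level 50).
Notation "\lprod_ ( i <- r | P ) F" := (\big[@lmul _/lconst 1]_(i <- r | P) F)
  (at level 36, F at level 36, i, r at level 50).

(* Combinatorial data attached to (lam, mu); all sequences are 1-indexed:    *)
(* lam j, mu j for 1 <= j <= n.                                              *)

Definition colheight (n : nat) (lam : nat -> nat) (k : nat) : nat :=
  count (fun j => k <= lam j)%N (iota 1 n).

Definition idx (n : nat) (lam : nat -> nat) (s : nat) : nat :=
  (n - colheight n lam s)%N.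

Definition acoefZ (n : nat) (lam : nat -> nat) (mu : nat -> int) (i : nat) : int :=
  - \sum_((n - i).+1 <= j < n.+1) ((lam j)%:Z + mu j).
Definition acoef (n : nat) (lam : nat -> nat) (mu : nat -> int) (i : nat) : nat :=
  if (0 < i < n)%N then `|acoefZ n lam mu i|%N else 0%N.

Definition mIdx (n : nat) (mu : nat -> int) : nat :=
  \max_(1 <= i < n.+1 | mu (n - i + 1)%N == -1) i.
Definition mIdx' (n : nat) (mu : nat -> int) : nat :=
  \max_(1 <= i < n.+1 | mu (n - i + 1)%N <= 0) i.

(* the fundamental weight varpi_j = - sum_{l > j} eps_l, as its coordinates *)
Definition varpi (j : nat) (l : nat) : int := if (j < l)%N then -1 else 0.

Definition lambda_at (n : nat) (lam : nat -> nat) (x : nat -> CC) (y : CC)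
  (l : nat) : int :=
  \sum_(s <- iota 1 (lam 1%N) | x s == y) varpi (idx n lam s) l.

(* sum_{x in C} eps^vee_l(lambda_x) x  (finite: over the distinct x_s) *)
Definition epsx (n : nat) (lam : nat -> nat) (x : nat -> CC) (l : nat) : CC :=
  \sum_(y <- undup [seq x s | s <- iota 1 (lam 1%N)])
     (lambda_at n lam x y l)%:~R * y.

Fixpoint chains (a : nat -> nat) (i len : nat) : seq (seq nat) :=
  match len with
  | 0 => [:: [::]]
  | len'.+1 => [seq r :: c | r <- iota 1 (a i), c <- chains a i.+1 len']
  end.

Definition rk (i : nat) (c : seq nat) (k : nat) : nat := nth 0%N c (k - i).

Section Alg.
Variables (n : nat) (lam : nat -> nat) (mu : nat -> int) (x : nat -> CC).
Variables (A : unitAlgType CC) (p eqp eqm : nat -> nat -> A).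

Local Notation a := (acoef n lam mu).
Local Notation N := (lam 1%N).
Local Notation is_ := (idx n lam).

Definition Pev (j : nat) (w : A) : A := \prod_(r <- iota 1 (a j)) (w - p j r).
Definition Prev (j r : nat) (w : A) : A :=
  \prod_(s <- iota 1 (a j) | s != r) (w - p j s).
Definition Zev (k : nat) (w : A) : A :=
  \prod_(s <- iota 1 N | is_ s == k) (w - (x s)%:A).

Definition Pser (j : nat) : lser A := \lprod_(r <- iota 1 (a j)) llin (p j r).
Definition Zser (k : nat) : lser A :=
  \lprod_(s <- iota 1 N | is_ s == k) llin ((x s)%:A).

(* g_i(z) = P_i(z) / P_{i-1}(z-1) * prod_{k=0}^{i-1} Z_k(z) *)
Definition gD (i : nat) : lser A :=
  lmul (lmul (Pser i) (\lprod_(r <- iota 1 (a i.-1)) linvlin (p i.-1 r + 1)))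
       (\lprod_(k <- iota 0 i) Zser k).

(* coefficient (without the factor 1/(z - p_{i,r_i})) and exponential of  *)
(* the (r_i,...,r_{j-1}) summand of e_{ij}                                  *)
Definition ecoef (i j : nat) (c : seq nat) : A :=
  let r := rk i c in
  Pev i.-1 (p i (r i) - 1)
  * (\prod_(k <- iota i (j.-1 - i)) Prev k (r k) (p k.+1 (r k.+1) - 1))
  * (\prod_(k <- iota i (j - i)) Prev k (r k) (p k (r k)))^-1
  * (\prod_(k <- iota i (j - i)) Zev k (p k (r k))).
Definition eexp (i j : nat) (c : seq nat) : A :=
  \prod_(k <- iota i (j - i)) eqp k (rk i c k).

Definition fcoef (j i : nat) (c : seq nat) : A :=
  let r := rk i c in
  Pev j (p j.-1 (r j.-1) + 1)
  * (\prod_(k <- iota i.+1 (j.-1 - i)) Prev k (r k) (p k.-1 (r k.-1) + 1))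
  * (\prod_(k <- iota i (j - i)) Prev k (r k) (p k (r k)))^-1.
Definition fexp (j i : nat) (c : seq nat) : A :=
  \prod_(k <- iota i (j - i)) eqm k (rk i c k).

Definition eD (i j : nat) : lser A :=
  if i == j then lconst 1 else
  lopp (\lsum_(c <- chains a i (j - i))
          lmul (lmul (lconst (ecoef i j c)) (linvlin (p i (rk i c i))))
               (lconst (eexp i j c))).

Definition fD (j i : nat) : lser A :=
  if i == j then lconst 1 else
  \lsum_(c <- chains a i (j - i))
     lmul (lmul (lconst (fcoef j i c)) (linvlin (p i (rk i c i) + 1)))
          (lconst (fexp j i c)).

Definition TD (al be : nat) : lser A :=
  \lsum_(i <- iota 1 (minn al be)) lmul (lmul (fD al i) (gD i)) (eD i be).

(* claimed diagonal value (i <= m), minus z *)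
Definition Tdiag (i : nat) : A :=
  \sum_(r <- iota 1 (a i.-1)) (p i.-1 r + 1) - \sum_(r <- iota 1 (a i)) p i r
  + (epsx n lam x i)%:A.

Definition Tup (i j : nat) : A :=
  - \sum_(c <- chains a i (j - i)) ecoef i j c * eexp i j c.
Definition Tlow (j i : nat) : A :=
  \sum_(c <- chains a i (j - i)) fcoef j i c * fexp j i c.

End Alg.

(* Main.v *)
Require Import Defs.
From HB Require Import structures.
From mathcomp Require Import all_boot all_order all_algebra.
From mathcomp Require Import complex Rstruct.
From mathcomp Require Import boolp zify ring.
Import Order.TTheory GRing.Theory Num.Theory.
Local Open Scope ring_scope.
Set Implicit Arguments.
Unset Strict Implicit.
Unset Printing Implicit Defensive.

(* Write T_{al,be} = sum_i f_{al,i} g_i e_{i,be}. Since f_{al,i} and e_{i,be} are of order z^-1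
   off the diagonal and g_i has leading term z^{-mu_(n-i+1)} with -mu_(n-i+1) <= 1, the
   coefficients of nonnegative powers of z come from the single term i = min(al, be). What
   remains is that the coefficients of negative powers vanish, i.e. that the poles cancel.

   Let F_{i,r} and E_{i,s} be the sums, over the chains starting at r resp. s on level i, of the
   z-independent parts of f_{al,i} and e_{i,be}. Moving the exponentials outwards, the i-th term
   becomes - sum_{r,s} F_{i,r} M_{r,s}(z) E_{i,s} with M_{r,s}(z) in the commutative subring
   generated by the p's, and partial fractions show by induction on j < min(al, be) that
     sum_{i <= j} (term i)
       = - sum_r F_{j,r} P_{j,r}(p_{j,r}) (Z_0 ... Z_{j-1})(p_{j,r}) / (z - p_{j,r}) E_{j,r}
   modulo polynomials in z: the pole at z = p_{j,r} + 1 of the term j + 1 cancels what is left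
   of the terms i <= j, and only the pairs r = s of the level j + 1 survive. For
   j + 1 = min(al, be) nothing survives. *)

(** * Laurent series up to Leibniz equality *)

Section LaurentSeries.
Variable R : nzRingType.
Implicit Types (s t u : lser R) (a b c : R) (k : int).

(** Leibniz equality lets products be rewritten inside larger products. Sums are compared through
    [lcoef] instead: [lzero] has [ldeg] 0 and is not neutral for [ladd] on series of negative
    degree. *)
Lemma lser_ext s t : ldeg s = ldeg t -> lcf s =1 lcf t -> s = t.
Proof.
by case: s t => [d f] [d' g] /= -> fg; congr LSer; apply: funext.
Qed.

(** A Cauchy product at index [j] only sees coefficients up to [j], so truncated polynomials compute
    it; associativity and, later, commutativity are inherited from polynomials. *)
Lemma lcf_lmul s t j N : (j < N)%N ->
  lcf (lmul s t) j = (\poly_(i < N) lcf s i * \poly_(i < N) lcf t i)`_j.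
Proof.
move=> ltjN; rewrite coefM; apply: eq_bigr => i _.
have ltiN : (i < N)%N by apply: leq_ltn_trans ltjN; rewrite -ltnS.
by rewrite !coef_poly ltiN (leq_ltn_trans (leq_subr i j) ltjN).
Qed.

Lemma lmulA s t u : lmul s (lmul t u) = lmul (lmul s t) u.
Proof.
apply: lser_ext => [|j]; first exact: addrA.
rewrite !(@lcf_lmul _ _ _ j.+1) //.
have trunc (v w : lser R) i : (i < j.+1)%N ->
    lcf (lmul v w) i = (\poly_(l < j.+1) lcf v l * \poly_(l < j.+1) lcf w l)`_i.
  exact: lcf_lmul.
set S := \poly_(i < j.+1) lcf s i; set T := \poly_(i < j.+1) lcf t i.
set U := \poly_(i < j.+1) lcf u i.
transitivity ((S * (T * U))`_j).
  rewrite !coefM; apply: eq_bigr => i _; congr (_ * _).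
  by rewrite coef_poly ltnS leq_subr trunc // ltnS leq_subr.
rewrite mulrA !coefM; apply: eq_bigr => i _; congr (_ * _).
by rewrite coef_poly ltn_ord trunc.
Qed.

Lemma lcf_lconstl a s j : lcf (lmul (lconst a) s) j = a * lcf s j.
Proof.
rewrite /= big_ord_recl /= subn0 big1 ?addr0 // => i _.
by rewrite /= mul0r.
Qed.

Lemma lcf_lconstr a s j : lcf (lmul s (lconst a)) j = lcf s j * a.
Proof.
rewrite /= big_ord_recr /= subnn big1 ?add0r // => i _.
by rewrite subn_eq0 leqNgt ltn_ord /= mulr0.
Qed.

Lemma lmul1l s : lmul (lconst 1) s = s.
Proof.
apply: lser_ext => [|j]; first exact: add0r.
by rewrite lcf_lconstl mul1r.
Qed.

Lemma lmul1r s : lmul s (lconst 1) = s.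
Proof.
apply: lser_ext => [|j]; first exact: addr0.
by rewrite lcf_lconstr mulr1.
Qed.

HB.instance Definition _ :=
  Monoid.isLaw.Build (lser R) (lconst 1) (@lmul R) lmulA lmul1l lmul1r.

Lemma lcoef_eq0 s k : ldeg s < k -> lcoef s k = 0.
Proof. by rewrite /lcoef; case E: (ldeg s - k) => [j|j] // ?; lia. Qed.

Lemma lcoefE s k j : ldeg s - k = Posz j -> lcoef s k = lcf s j.
Proof. by rewrite /lcoef => ->. Qed.

Lemma lcoef_lzero k : lcoef (@lzero R) k = 0.
Proof. by rewrite /lcoef; case: (_ - _). Qed.

Lemma lcoef_lz k : lcoef (@lz R) k = (k == 1)%:R.
Proof.
rewrite /lcoef /=; case: (k =P 1) => [->//|k1].
by case E: (1 - k) => [[|j]|j] //; exfalso; lia.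
Qed.

Lemma lcoef_ladd s t k : lcoef (ladd s t) k = lcoef s k + lcoef t k.
Proof.
have [ltk|lek] := ltP (ldeg (ladd s t)) k.
  by rewrite !lcoef_eq0 ?addr0 //; move: ltk => /=; lia.
have [j Ej] : exists j : nat, ldeg (ladd s t) - k = j%:Z.
  by exists `|ldeg (ladd s t) - k|%N; lia.
by rewrite (lcoefE Ej) /=; congr (lcoef _ _ + lcoef _ _); move: Ej => /=; lia.
Qed.

Lemma lcoef_lopp s k : lcoef (lopp s) k = - lcoef s k.
Proof. by rewrite /lcoef /=; case: (_ - _) => // j; rewrite oppr0. Qed.

Lemma lcoef_lconst a k : lcoef (lconst a) k = if k == 0 then a else 0.
Proof.
rewrite /lcoef /= sub0r; case: k => [[|j]|j] //=.
Qed.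

Lemma lcoef_lconstl a s k : lcoef (lmul (lconst a) s) k = a * lcoef s k.
Proof.
rewrite /lcoef (_ : ldeg (lmul _ _) = ldeg s); last exact: add0r.
by case: (_ - _) => [j|j]; rewrite ?mulr0 // lcf_lconstl.
Qed.

Lemma lcoef_lconstr a s k : lcoef (lmul s (lconst a)) k = lcoef s k * a.
Proof.
rewrite /lcoef (_ : ldeg (lmul _ _) = ldeg s); last exact: addr0.
by case: (_ - _) => [j|j]; rewrite ?mul0r // lcf_lconstr.
Qed.

Lemma lcf_llin a j :
  lcf (llin a) j = if j == 0%N then 1 else if j == 1%N then - a else 0.
Proof.
by case: j => [|[|j]]; rewrite /lcoef /= ?subr0 ?subrr ?oppr0 ?addr0 ?add0r.
Qed.

Lemma lcf_lmulE s t j :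
  lcf (lmul s t) j = \sum_(i < j.+1) lcf s i * lcf t (j - i).
Proof. by []. Qed.

Lemma llin_linvlin a : lmul (llin a) (linvlin a) = lconst 1.
Proof.
apply: lser_ext => [//|[|j]].
  by rewrite lcf_lmulE big_ord1 lcf_llin mulr1.
rewrite lcf_lmulE !big_ord_recl big1; last by move=> i _; rewrite lcf_llin mul0r.
rewrite !lcf_llin mul1r addr0 mulNr (_ : (j.+1 - bump 0 0 = j)%N) ?subn1 //.
by rewrite [lcf _ _]/= exprS subrr.
Qed.

(** Termwise [a ^+ j * c = c * b ^+ j]. With [c] a product of exponentials and [a] a shift of [b],
    this moves the exponentials past a pole. *)
Lemma linvlin_comm_const a b c : a * c = c * b ->
  lmul (linvlin a) (lconst c) = lmul (lconst c) (linvlin b).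
Proof.
move=> abc; apply: lser_ext => [//|j].
rewrite lcf_lconstr lcf_lconstl /=.
by elim: j => [|j IH]; rewrite ?mul1r ?mulr1 // exprS -mulrA IH mulrA abc -mulrA -exprS.
Qed.

(* [s] written with [e] leading zeros, so that two series can be added with the same [ldeg]. *)
Definition lpad (e : nat) s : lser R :=
  LSer (ldeg s + e%:Z) (fun j => if (j < e)%N then 0 else lcf s (j - e)%N).

Lemma lcoef_lpad e s k : lcoef (lpad e s) k = lcoef s k.
Proof.
rewrite /lcoef /=; case E: (_ - k) => [j|j]; case E': (ldeg s - k) => [j'|j'] //.
- have -> : j = (e + j')%N by lia.
  by rewrite ltnNge leq_addr /= addKn.
- by rewrite (_ : j < e)%N //; lia.
- by lia.
Qed.

Lemma lmul_lpadl e s t : lmul (lpad e s) t = lpad e (lmul s t).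
Proof.
apply: lser_ext => [|j] /=; first by rewrite addrAC.
case: ltnP => [lt|le].
  by rewrite big1 // => i _; rewrite (_ : i < e)%N ?mul0r //; case: i => i /=; lia.
have -> : j.+1 = (e + (j - e).+1)%N by lia.
rewrite big_split_ord /= big1 ?add0r; last by move=> i _; rewrite ltn_ord mul0r.
apply: eq_bigr => i _; rewrite ltnNge leq_addr /= addKn.
by congr (_ * lcf t _); lia.
Qed.

Lemma lmul_lpadr e s t : lmul s (lpad e t) = lpad e (lmul s t).
Proof.
apply: lser_ext => [|j] /=; first by rewrite addrA.
case: ltnP => [lt|le].
  by rewrite big1 // => i _; rewrite (_ : j - i < e)%N ?mulr0 //; case: i => i /=; lia.
have -> : j.+1 = ((j - e).+1 + e)%N by lia.
rewrite big_split_ord /= [X in _ + X]big1 ?addr0; last first.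
  by move=> i _; rewrite (_ : _ - _ < e)%N ?mulr0 //; case: i => i /=; lia.
apply: eq_bigr => i _; case: i => i /= lti; rewrite ltnNge.
rewrite (_ : e <= j - i)%N /=; last by lia.
by congr (_ * lcf t _); lia.
Qed.

(** Padding brings both series to a common top exponent, where addition is coefficientwise;
    distributivity then reduces to that of [R]. *)
Lemma ladd_lpad s t : exists e e',
  [/\ ldeg (lpad e s) = ldeg (lpad e' t),
      ldeg (ladd s t) = ldeg (lpad e s)
    & forall j, lcf (ladd s t) j = lcf (lpad e s) j + lcf (lpad e' t) j].
Proof.
set d := ldeg (ladd s t).
have sd : ldeg s <= d by rewrite le_max lexx.
have td : ldeg t <= d by rewrite le_max lexx orbT.
exists `|d - ldeg s|%N, `|d - ldeg t|%N; split; rewrite /=; try by lia.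
move=> j; rewrite -[Num.max _ _]/d; clearbody d; congr (_ + _); rewrite /lcoef.
  by case E: (_ - _) => [i|i]; case: ltnP => ? //; try (exfalso; lia); congr lcf; lia.
by case E: (_ - _) => [i|i]; case: ltnP => ? //; try (exfalso; lia); congr lcf; lia.
Qed.

Lemma lcoef_add_cf s t u k : ldeg u = ldeg s -> ldeg t = ldeg s ->
  (forall j, lcf u j = lcf s j + lcf t j) -> lcoef u k = lcoef s k + lcoef t k.
Proof.
move=> us ts stu; rewrite /lcoef us ts.
by case: (_ - _) => // j; rewrite addr0.
Qed.

Lemma lcoef_mulDl s t u k :
  lcoef (lmul (ladd s t) u) k = lcoef (lmul s u) k + lcoef (lmul t u) k.
Proof.
have [e [e' [d1 d2 cf]]] := ladd_lpad s t.
rewrite -(lcoef_lpad e (lmul s u)) -(lcoef_lpad e' (lmul t u)) -!lmul_lpadl.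
apply: lcoef_add_cf => [||j].
- exact: (congr1 (fun d => d + ldeg u) d2).
- exact: (congr1 (fun d => d + ldeg u) (esym d1)).
rewrite !lcf_lmulE -big_split; apply: eq_bigr => i _.
by rewrite cf -[RHS]mulrDl.
Qed.

Lemma lcoef_mulDr s t u k :
  lcoef (lmul u (ladd s t)) k = lcoef (lmul u s) k + lcoef (lmul u t) k.
Proof.
have [e [e' [d1 d2 cf]]] := ladd_lpad s t.
rewrite -(lcoef_lpad e (lmul u s)) -(lcoef_lpad e' (lmul u t)) -!lmul_lpadr.
apply: lcoef_add_cf => [||j].
- exact: (congr1 (fun d => ldeg u + d) d2).
- exact: (congr1 (fun d => ldeg u + d) (esym d1)).
rewrite !lcf_lmulE -big_split; apply: eq_bigr => i _.
by rewrite cf -[RHS]mulrDr.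
Qed.

Lemma lmul_lopp s t : lmul s (lopp t) = lopp (lmul s t).
Proof.
apply: lser_ext => //= j; rewrite -sumrN.
by apply: eq_bigr => i _; rewrite mulrN.
Qed.

Section Sums.
Variables (I : Type) (r : seq I) (F : I -> lser R).

Lemma lcoef_lsum k : lcoef (\lsum_(i <- r) F i) k = \sum_(i <- r) lcoef (F i) k.
Proof.
by elim/big_ind2: _ => [|s x t y <- <-|//]; rewrite ?lcoef_lzero ?lcoef_ladd.
Qed.

Lemma lcoef_lsum_mull t k :
  lcoef (lmul (\lsum_(i <- r) F i) t) k = \sum_(i <- r) lcoef (lmul (F i) t) k.
Proof.
elim/big_ind2: _ => [|s x u y <- <-|//]; last by rewrite lcoef_mulDl.
rewrite /lcoef; case: (_ - _) => // j /=.
by apply: big1 => i _; rewrite mul0r.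
Qed.

Lemma lcoef_lsum_mulr t k :
  lcoef (lmul t (\lsum_(i <- r) F i)) k = \sum_(i <- r) lcoef (lmul t (F i)) k.
Proof.
elim/big_ind2: _ => [|s x u y <- <-|//]; last by rewrite lcoef_mulDr.
rewrite /lcoef; case: (_ - _) => // j /=.
by apply: big1 => i _; rewrite mulr0.
Qed.

End Sums.

Section Products.
Variables (I : Type) (r : seq I) (P : pred I).

Lemma ldeg_lprod (F : I -> lser R) :
  ldeg (\lprod_(i <- r | P i) F i) = \sum_(i <- r | P i) ldeg (F i).
Proof. by elim/big_rec2: _ => // i x y _ <-. Qed.

Lemma lcf0_lprod (F : I -> lser R) : (forall i, P i -> lcf (F i) 0 = 1) ->
  lcf (\lprod_(i <- r | P i) F i) 0 = 1.
Proof.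
move=> F1; elim/big_ind: _ => //= s t s1 t1.
by rewrite big_ord1 s1 t1 mulr1.
Qed.

Lemma lcf1_lmul s t : lcf s 0 = 1 -> lcf t 0 = 1 ->
  lcf (lmul s t) 1 = lcf s 1 + lcf t 1.
Proof.
by move=> s1 t1; rewrite /= big_ord_recl big_ord1 /= s1 t1 mul1r mulr1 addrC.
Qed.

Lemma lcf1_lprod (F : I -> lser R) : (forall i, P i -> lcf (F i) 0 = 1) ->
  lcf (\lprod_(i <- r | P i) F i) 1 = \sum_(i <- r | P i) lcf (F i) 1.
Proof.
move=> F1; have F0 := lcf0_lprod F1; move: F0.
suff: lcf (\lprod_(i <- r | P i) F i) 0 = 1 /\
      lcf (\lprod_(i <- r | P i) F i) 1 = \sum_(i <- r | P i) lcf (F i) 1 by case.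
elim/big_rec2: _ => [//|i x y Pi [y0 y1]].
split; last by rewrite lcf1_lmul ?F1 // y1.
by rewrite /= big_ord1 F1 // y0 mulr1.
Qed.

End Products.

End LaurentSeries.

(** * Change of the coefficient ring *)

Section Map.
Variables (R S : nzRingType) (f : {rmorphism R -> S}).

Definition lmap (s : lser R) : lser S := LSer (ldeg s) (f \o lcf s).

Lemma lcoef_lmap s k : lcoef (lmap s) k = f (lcoef s k).
Proof. by rewrite /lcoef /=; case: (_ - _) => //= ?; rewrite rmorph0. Qed.

Lemma lmap_lmul s t : lmap (lmul s t) = lmul (lmap s) (lmap t).
Proof.
apply: lser_ext => // j; rewrite -[LHS]/(f (lcf (lmul s t) j)) !lcf_lmulE.
by rewrite rmorph_sum; apply: eq_bigr => i _; rewrite rmorphM.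
Qed.

Lemma lmap_lconst a : lmap (lconst a) = lconst (f a).
Proof. by apply: lser_ext => // -[|j] //=; rewrite rmorph0. Qed.

Lemma lmap_linvlin a : lmap (linvlin a) = linvlin (f a).
Proof. by apply: lser_ext => // j; apply: rmorphXn. Qed.

Lemma lmap_llin a : lmap (llin a) = llin (f a).
Proof.
apply: lser_ext => // j; rewrite -[LHS]/(f (lcf (llin a) j)) !lcf_llin.
by case: j => [|[|j]]; rewrite ?rmorph1 ?rmorphN ?rmorph0.
Qed.

Lemma lmap_lprod (I : Type) (r : seq I) (P : pred I) F :
  lmap (\lprod_(i <- r | P i) F i) = \lprod_(i <- r | P i) lmap (F i).
Proof.
by apply: big_morph; [apply: lmap_lmul | rewrite lmap_lconst rmorph1].
Qed.

End Map.

(** * Partial fractions over a commutative ring *)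

Section PolynomialAction.
Variable S : comUnitRingType.
Implicit Types (Q G : {poly S}) (phi : int -> S) (s t : lser S) (k : int).

Lemma lmulC s t : lmul s t = lmul t s.
Proof.
apply: lser_ext => [|j]; first exact: addrC.
by rewrite !(@lcf_lmul _ _ _ j j.+1) // mulrC.
Qed.

HB.instance Definition _ :=
  SemiGroup.isCommutativeLaw.Build (lser S) (@lmul S) lmulC.

(* [Q * phi] for the doubly infinite series [phi], a module over the polynomials in [z]. *)
Definition pact Q phi k : S := \sum_(i < size Q) Q`_i * phi (k - i%:Z).

Lemma pactE N Q phi k : (size Q <= N)%N ->
  pact Q phi k = \sum_(i < N) Q`_i * phi (k - i%:Z).
Proof.
move=> leQN; rewrite /pact (big_ord_widen _ (fun i => Q`_i * phi (k - i%:Z)) leQN).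
rewrite big_mkcond; apply: eq_bigr => i _; case: ltnP => // leQi.
by rewrite nth_default ?mul0r.
Qed.

Lemma pactD Q G phi k : pact (Q + G) phi k = pact Q phi k + pact G phi k.
Proof.
rewrite !(@pactE (maxn (size Q) (size G))) ?size_polyD ?leq_maxl ?leq_maxr //.
by rewrite -big_split; apply: eq_bigr => i _; rewrite coefD mulrDl.
Qed.

Lemma pactC c phi k : pact c%:P phi k = c * phi k.
Proof.
by rewrite (@pactE 1) ?size_polyC_leq1 // big_ord1 coefC subr0.
Qed.

Lemma pactMX Q phi k : pact (Q * 'X) phi k = pact Q phi (k - 1).
Proof.
rewrite (@pactE (size Q).+1) ?(leq_trans (size_polyMleq _ _)) ?size_polyX ?addn2 //.
rewrite big_ord_recl coefMX mul0r add0r; apply: eq_bigr => i _.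
by rewrite coefMX lift0 /=; congr (_ * phi _); lia.
Qed.

Lemma eq_pact Q phi psi k : phi =1 psi -> pact Q phi k = pact Q psi k.
Proof. by move=> e; apply: eq_bigr => i _; rewrite e. Qed.

Lemma pactCM c Q phi k : pact (c%:P * Q) phi k = c * pact Q phi k.
Proof.
rewrite (@pactE (size Q)) ?mul_polyC ?size_scale_leq // mulr_sumr.
by apply: eq_bigr => i _; rewrite coefZ mulrA.
Qed.

Lemma pactM Q G phi k : pact (Q * G) phi k = pact Q (pact G phi) k.
Proof.
elim/poly_ind: Q k => [|Q c IH] k.
  by rewrite mul0r /pact size_poly0 !big_ord0.
by rewrite mulrDl mulrAC !pactD pactCM pactC !pactMX IH.
Qed.

Lemma pact_sum I (r : seq I) (F : I -> {poly S}) phi k :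
  pact (\sum_(i <- r) F i) phi k = \sum_(i <- r) pact (F i) phi k.
Proof.
elim/big_ind2: _ => [|Q x G y <- <-|//]; last exact: pactD.
by rewrite /pact size_poly0 big_ord0.
Qed.

(** Turns products of linear series into polynomials acting by [pact], so that evaluation and
    division of polynomials become available. *)
Lemma lcoef_llinM a s k :
  lcoef (lmul (llin a) s) k = pact ('X - a%:P) (lcoef s) k.
Proof.
rewrite -polyCN pactD -['X]mul1r pactMX !pactC mul1r mulNr /llin lcoef_mulDl.
congr (_ + _); last first.
  by rewrite lmulC lmul_lopp lcoef_lopp lmulC lcoef_lconstl.
rewrite /lcoef [ldeg _]/= (_ : 1 + ldeg s - k = ldeg s - (k - 1)); last by lia.
case: (_ - _) => // j; rewrite lcf_lmulE big_ord_recl mul1r subn0.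
by rewrite big1 ?addr0 // => i _; rewrite mul0r.
Qed.

Lemma lcoef_lprod_llinM I (r : seq I) (P : pred I) (F : I -> S) s k :
  lcoef (lmul (\lprod_(i <- r | P i) llin (F i)) s) k
  = pact (\prod_(i <- r | P i) ('X - (F i)%:P)) (lcoef s) k.
Proof.
elim/big_rec2: _ k => [|i Q t Pi IH] k; first by rewrite lmul1l pactC mul1r.
by rewrite -lmulA lcoef_llinM pactM; apply: eq_pact.
Qed.

Lemma pact_linvlin Q a (k : nat) :
  pact Q (lcoef (linvlin a)) (Negz k) = Q.[a] * a ^+ k.
Proof.
rewrite horner_coef mulr_suml; apply: eq_bigr => i _; rewrite -mulrA -exprD.
by rewrite /lcoef /= (_ : -1 - (Negz k - i%:Z) = (i + k)%N%:Z) //; lia.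
Qed.

Lemma pact_lconst Q a (k : nat) : pact Q (lcoef (lconst a)) (Negz k) = 0.
Proof.
by apply: big1 => i _; rewrite lcoef_lconst; case: eqP => [?|]; [lia|rewrite mulr0].
Qed.

End PolynomialAction.

Section PartialFractions.
Variables (S : comUnitRingType) (T : eqType) (rs : seq T) (b : T -> S).
Hypothesis rs_uniq : uniq rs.
Hypothesis b_unit :
  {in rs &, forall r s, r != s -> b r - b s \is a GRing.unit}.

Local Notation B := (\prod_(r <- rs) ('X - (b r)%:P)).
Local Notation Bx r := (\prod_(s <- rs | s != r) ('X - (b s)%:P)).
Local Notation V := (\lprod_(r <- rs) linvlin (b r)).

Lemma lprod_llin_linvlin (P : pred T) :
  lmul (\lprod_(r <- rs | P r) llin (b r)) (\lprod_(r <- rs | P r) linvlin (b r))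
  = lconst 1.
Proof. by rewrite -big_split big1 // => r _; apply: llin_linvlin. Qed.

Lemma horner_prodXsubC (P : pred T) w :
  (\prod_(r <- rs | P r) ('X - (b r)%:P)).[w] = \prod_(r <- rs | P r) (w - b r).
Proof. by rewrite horner_prod; apply: eq_bigr => r _; rewrite hornerXsubC. Qed.

Lemma Bx_unit r : r \in rs -> (Bx r).[b r] \is a GRing.unit.
Proof.
move=> rin; rewrite horner_prodXsubC big_seq_cond.
apply: (big_ind (fun x => x \is a GRing.unit)); first exact: unitr1.
  by move=> x y xu yu; rewrite unitrM xu.
by move=> s /andP[sin ns]; apply: b_unit; rewrite // eq_sym.
Qed.

Lemma Bx_root r s : s \in rs -> r != s -> (Bx r).[b s] = 0.
Proof.
move=> sin nrs; rewrite horner_prodXsubC -big_filter.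
have sin' : s \in [seq s' <- rs | s' != r] by rewrite mem_filter eq_sym nrs.
by rewrite (bigD1_seq s sin') ?filter_uniq //= subrr mul0r.
Qed.

Lemma BxE r : r \in rs -> B = ('X - (b r)%:P) * Bx r.
Proof. by move=> rin; rewrite (bigD1_seq r). Qed.

Lemma pact_Bx r : r \in rs -> pact (Bx r) (lcoef V) =1 lcoef (linvlin (b r)).
Proof.
move=> rin k; rewrite -lcoef_lprod_llinM (bigD1_seq r) //=.
by rewrite lmulA -(lmulC (linvlin _)) -lmulA lprod_llin_linvlin lmul1r.
Qed.

(** [Q] minus its interpolation polynomial vanishes at every node. Divisibility by [B] follows even
    in the presence of zero divisors, because the differences of the nodes are units. *)
Lemma lagrange (Q : {poly S}) : exists D,
  Q = D * B + \sum_(r <- rs) (Q.[b r] * (Bx r).[b r]^-1)%:P * Bx r.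
Proof.
set L := \sum_(r <- rs) _.
have [|| D QD] := @uniq_roots_prod_XsubC S (Q - L) [seq b r | r <- rs].
- apply/allP => _ /mapP[s sin ->]; rewrite rootE hornerD hornerN subr_eq0.
  rewrite horner_sum (bigD1_seq s) //= [X in _ + X]big1_seq; last first.
    by move=> r /andP[/= nrs _]; rewrite hornerM (Bx_root sin nrs) mulr0.
  by rewrite hornerM hornerC mulrVK ?Bx_unit ?addr0.
- elim: rs rs_uniq b_unit => //= r l IH /andP[rl ul] bu.
  rewrite IH ?andbT //; last by move=> s t sl tl; apply: bu; rewrite inE ?sl ?tl orbT.
  apply/allP => _ /mapP[s sin ->]; rewrite /diff_roots mulrC eqxx /=.
  apply: bu; rewrite ?inE ?eqxx ?sin ?orbT //.
  by apply: contraNneq rl => <-.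
by exists D; rewrite big_map in QD; rewrite -QD subrK.
Qed.

(** In the form given by [lagrange], [D * B] turns [V = 1 / B] into the polynomial [D], without
    negative powers, and each [Bx r] turns it into a single pole at [b r]. *)
Lemma partial_fractions (Q : {poly S}) (k : nat) :
  pact Q (lcoef V) (Negz k)
  = \sum_(r <- rs) Q.[b r] * (b r) ^+ k * (Bx r).[b r]^-1.
Proof.
have [D {1}->] := lagrange Q; rewrite pactD pactM.
have BV : pact B (lcoef V) =1 lcoef (lconst 1).
  by move=> l; rewrite -lcoef_lprod_llinM lprod_llin_linvlin.
rewrite (eq_pact _ _ BV) pact_lconst add0r pact_sum; apply: eq_big_seq => r rin.
rewrite pactM (eq_pact _ _ (pact_Bx rin)) pact_linvlin hornerC.
by rewrite mulrAC.
Qed.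

(* With [B = B.[q] + Delta * ('X - q)], the quotient [Delta] takes the value [(Bx r).[q]]
   at [b r]; [b r - q] need not be invertible, hence the detour through polynomials. *)
Lemma partial_fractions_pole (G : {poly S}) q (k : nat) :
  B.[q] * pact G (lcoef (lmul V (linvlin q))) (Negz k)
  = G.[q] * q ^+ k
    - \sum_(r <- rs) G.[b r] * (b r) ^+ k * (Bx r).[q] * (Bx r).[b r]^-1.
Proof.
have div (Q : {poly S}) : exists D, Q = Q.[q]%:P + D * ('X - q%:P).
  have /factor_theorem[D QD] : root (Q - Q.[q]%:P) q.
    by rewrite rootE hornerD hornerN hornerC subrr.
  by exists D; rewrite -QD addrC subrK.
have [D BD] := div B; set W := lmul V (linvlin q).
have actq : pact ('X - q%:P) (lcoef W) =1 lcoef V.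
  by move=> l; rewrite -lcoef_llinM /W lmulC -lmulA -(lmulC (llin q)) llin_linvlin lmul1r.
have actB : pact B (lcoef W) =1 lcoef (linvlin q).
  by move=> l; rewrite -lcoef_lprod_llinM lmulA lprod_llin_linvlin lmul1l.
have DV r : r \in rs -> D.[b r] = (Bx r).[q].
  move=> rin; have [Dr BrD] := div (Bx r).
  (* This formula follows by cancelling the monic, hence regular, factor ['X - q]. Evaluated at
     [b r], with [BrD], it leaves [(Bx r).[q]]. *)
  have -> : D = Bx r + (q - b r)%:P * Dr.
    apply: (monic_rreg (monicXsubC q)); rewrite /=.
    apply: (addrI B.[q]%:P); rewrite -BD mulrDl (BxE rin) hornerM hornerXsubC.
    rewrite -mulrA [Dr * _](_ : _ = Bx r - (Bx r).[q]%:P); last first.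
      by rewrite {1}BrD addrAC subrr add0r.
    rewrite polyCM !polyCB; ring.
  rewrite hornerD hornerM hornerC {1}BrD hornerD hornerC hornerM hornerXsubC; ring.
(* On [W], the factor [B] leaves only the pole at [q], and ['X - q] leaves only [V]; multiplying
   [BD] by [G] therefore separates the two kinds of poles. *)
have -> : B.[q] * pact G (lcoef W) (Negz k)
    = pact G (lcoef (linvlin q)) (Negz k) - pact (G * D) (lcoef V) (Negz k).
  rewrite -(eq_pact _ _ actB) -(eq_pact _ _ actq) -!pactM -pactCM.
  have -> : G * B = B.[q]%:P * G + G * D * ('X - q%:P) by rewrite {1}BD; ring.
  by rewrite pactD addrK.
rewrite pact_linvlin partial_fractions; congr (_ - _).
by apply: eq_big_seq => r rin; rewrite hornerM DV //; ring.
Qed.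

End PartialFractions.

(** * Commutative subrings *)

(* The centre of the centralizer of [G]: a commutative subring closed under inverses, which
   contains [G] as soon as the elements of [G] commute. *)
Section Bicommutant.
Variables (A : unitRingType) (G : A -> Prop).

Definition commutant (P : A -> Prop) (x : A) : Prop :=
  forall y, P y -> GRing.comm x y.

Definition bicomm : {pred A} :=
  fun x => `[< commutant G x /\ commutant (commutant G) x >].

Lemma bicommP x :
  reflect (commutant G x /\ commutant (commutant G) x) (x \in bicomm).
Proof. exact: asboolP. Qed.

Fact bicomm_divring_closed : divring_closed bicomm.
Proof.
have comm1 P : commutant P 1 by move=> y _; apply/commr_sym/commr1.
split=> [|x y|x y].
- by apply/bicommP; split; apply: comm1.
- move=> /bicommP[x1 x2] /bicommP[y1 y2]; apply/bicommP.
  by split=> z Pz; apply/commr_sym/commrB; apply/commr_sym; auto.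
move=> /bicommP[x1 x2] /bicommP[y1 y2]; apply/bicommP.
by split=> z Pz; apply/commr_sym/commrM; try apply: commrV; apply/commr_sym; auto.
Qed.
HB.instance Definition _ := GRing.isDivringClosed.Build A bicomm bicomm_divring_closed.

Record bicommutant := Bicommutant { bc_val : A; _ : bc_val \in bicomm }.
HB.instance Definition _ := [isSub for bc_val].
HB.instance Definition _ := [Choice of bicommutant by <:].
HB.instance Definition _ := [SubChoice_isSubUnitRing of bicommutant by <:].

Fact bicommutant_mulC : commutative (@GRing.mul bicommutant).
Proof.
move=> x y; apply: val_inj; rewrite !rmorphM.
have /bicommP[x1 x2] := valP x; have /bicommP[y1 y2] := valP y.
exact: x2.
Qed.
HB.instance Definition _ :=
  GRing.PzRing_hasCommutativeMul.Build bicommutant bicommutant_mulC.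

Lemma mem_bicomm x : (forall y z, G y -> G z -> GRing.comm y z) -> G x -> x \in bicomm.
Proof.
move=> Gcomm Gx; apply/bicommP; split=> y; first exact: Gcomm.
by move=> yG; apply/commr_sym/yG.
Qed.

End Bicommutant.

Lemma lmul_lconst (R : nzRingType) (b c : R) :
  lmul (lconst b) (lconst c) = lconst (b * c).
Proof. by apply: lser_ext => // -[|j]; rewrite lcf_lconstl //= mulr0. Qed.

(** * Chains of level indices *)

Lemma rk_cons i r c k : (i < k)%N -> rk i (r :: c) k = rk i.+1 c k.
Proof. by rewrite /rk => ik; rewrite -(subnSK ik). Qed.

Lemma rk_head i r c : rk i (r :: c) i = r.
Proof. by rewrite /rk subnn. Qed.

Lemma rk_chains a i len c k : c \in chains a i len -> (i <= k < i + len)%N ->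
  rk i c k \in iota 1 (a k).
Proof.
elim: len i c k => [|len IH] i c k; first by rewrite addn0; lia.
case/allpairsPdep=> r [c' [rin c'in ->]] /andP[]; rewrite leq_eqVlt.
case/orP => [/eqP <- _|ik kl]; first by rewrite rk_head.
by rewrite rk_cons // IH // ik; move: kl; rewrite addnS.
Qed.

(** * Cancellation of the poles *)

Section Lax.
Variables (n : nat) (lam : nat -> nat) (mu : nat -> int) (x : nat -> CC)
          (A : unitAlgType CC) (p eqp eqm : nat -> nat -> A).
Local Notation a := (acoef n lam mu).
Local Notation ok i r := ((0 < i < n)%N && (0 < r <= a i)%N).
Local Notation lev j := (iota 1 (a j)).

Hypothesis e_comm : forall i r j s, ok i r -> ok j s ->
     [/\ eqp i r * eqp j s = eqp j s * eqp i r,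
         eqp i r * eqm j s = eqm j s * eqp i r &
         eqm i r * eqm j s = eqm j s * eqm i r].
Hypothesis e_inv :
  forall i r, ok i r -> eqp i r * eqm i r = 1 /\ eqm i r * eqp i r = 1.
Hypothesis eqp_p : forall i r j s, ok i r -> ok j s ->
     eqp i r * p j s - p j s * eqp i r = - ((i == j) && (r == s))%:R * eqp i r.
Hypothesis eqm_p : forall i r j s, ok i r -> ok j s ->
     eqm i r * p j s - p j s * eqm i r = ((i == j) && (r == s))%:R * eqm i r.
Lemma lev_ok j r : (r \in lev j) = ok j r.
Proof.
rewrite mem_iota add1n ltnS /acoef.
by case: ifP => //= _; rewrite leqn0; case: r.
Qed.

Variables (S : comUnitRingType) (v : {rmorphism S -> A}).
Variables (ph : nat -> nat -> S) (xh : nat -> S).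
Hypothesis v_ph : forall i r, r \in lev i -> v (ph i r) = p i r.
Hypothesis v_xh : forall s, v (xh s) = (x s)%:A.
Hypothesis ph_unit : forall j,
  {in lev j &, forall r s, r != s -> ph j r - ph j s \is a GRing.unit}.

Definition Ps j : {poly S} := \prod_(r <- lev j) ('X - (ph j r)%:P).
Definition Px j r : {poly S} := \prod_(s <- lev j | s != r) ('X - (ph j s)%:P).
Definition Zs k : {poly S} :=
  \prod_(s <- iota 1 (lam 1%N) | idx n lam s == k) ('X - (xh s)%:P).
Definition Zlt j : {poly S} := \prod_(k <- iota 0 j) Zs k.

Lemma val_horner_prod (r : seq nat) (P : pred nat) (F : nat -> S) (w : S) :
  v (\prod_(i <- r | P i) ('X - (F i)%:P)).[w]
  = \prod_(i <- r | P i) (v w - v (F i)).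
Proof.
rewrite horner_prod rmorph_prod; apply: eq_bigr => i _.
by rewrite hornerXsubC rmorphB.
Qed.

Lemma Pev_val j w : Pev n lam mu p j (v w) = v (Ps j).[w].
Proof.
rewrite val_horner_prod; apply: eq_big_seq => r rin.
by rewrite v_ph.
Qed.

Lemma Prev_val j r w : Prev n lam mu p j r (v w) = v (Px j r).[w].
Proof.
rewrite val_horner_prod [LHS]big_seq_cond [RHS]big_seq_cond; apply: eq_bigr => s /andP[sin _].
by rewrite v_ph.
Qed.

Lemma Zev_val k w : Zev n lam x k (v w) = v (Zs k).[w].
Proof. by rewrite val_horner_prod; apply: eq_bigr => s _; rewrite v_xh. Qed.

Lemma val_ph1 i r : r \in lev i -> p i r + 1 = v (ph i r + 1).
Proof. by move=> rin; rewrite rmorphD rmorph1 v_ph. Qed.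

Lemma val_phB1 i r : r \in lev i -> p i r - 1 = v (ph i r - 1).
Proof. by move=> rin; rewrite rmorphB rmorph1 v_ph. Qed.

Lemma Px_unit j r : r \in lev j -> (Px j r).[ph j r] \is a GRing.unit.
Proof. by move=> rin; apply: Bx_unit rin; apply: ph_unit. Qed.

Lemma Px_root j r s : s \in lev j -> r != s -> (Px j r).[ph j s] = 0.
Proof. by apply: Bx_root; apply: iota_uniq. Qed.

Lemma PsE j r : r \in lev j -> Ps j = ('X - (ph j r)%:P) * Px j r.
Proof. by apply: BxE; apply: iota_uniq. Qed.

(** * Elements commuting with values of [Px] and [Zs] *)

Section Commutation.
Variables (u : A).

Lemma comm_val_horner (r : seq nat) (P : pred nat) (F : nat -> S) (w : S) :
  {in r, forall i, P i -> GRing.comm u (v (F i))} -> GRing.comm u (v w) ->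
  GRing.comm u (v (\prod_(i <- r | P i) ('X - (F i)%:P)).[w]).
Proof.
move=> uF uw; rewrite val_horner_prod big_seq_cond.
by apply: commr_prod => i /andP[iin Pi]; apply: commrB => //; apply: uF.
Qed.

Lemma comm_Zs k w : GRing.comm u (v w) -> GRing.comm u (v (Zs k).[w]).
Proof.
apply: comm_val_horner => s _ _; rewrite v_xh /GRing.comm.
by rewrite mulr_algl mulr_algr.
Qed.

Lemma comm_Px j r w : {in lev j, forall s, s != r -> GRing.comm u (p j s)} ->
  GRing.comm u (v w) -> GRing.comm u (v (Px j r).[w]).
Proof.
by move=> up; apply: comm_val_horner => s sin nsr; rewrite v_ph //; apply: up.
Qed.

End Commutation.

Lemma eqm_comm i r j s : r \in lev i -> s \in lev j -> ~~ ((i == j) && (r == s)) ->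
  GRing.comm (eqm i r) (p j s).
Proof.
rewrite !lev_ok => ir js /negbTE nijrs; apply/eqP; rewrite -subr_eq0.
by rewrite eqm_p // nijrs mul0r.
Qed.

Lemma eqp_comm i r j s : r \in lev i -> s \in lev j -> ~~ ((i == j) && (r == s)) ->
  GRing.comm (eqp i r) (p j s).
Proof.
rewrite !lev_ok => ir js /negbTE nijrs; apply/eqP; rewrite -subr_eq0.
by rewrite eqp_p // nijrs oppr0 mul0r.
Qed.

Lemma eqm_shift i r : r \in lev i -> eqm i r * p i r = (p i r + 1) * eqm i r.
Proof.
rewrite lev_ok => ir; have := eqm_p ir ir; rewrite !eqxx mul1r => /eqP.
by rewrite subr_eq => /eqP ->; rewrite mulrDl mul1r addrC.
Qed.

(** [gD] over the commutative ring [S], where factors may be reordered and partial fractions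
    apply. *)
Definition gS i : lser S :=
  lmul (lmul (\lprod_(r <- lev i) llin (ph i r))
             (\lprod_(r <- lev i.-1) linvlin (ph i.-1 r + 1)))
       (\lprod_(k <- iota 0 i)
          \lprod_(s <- iota 1 (lam 1%N) | idx n lam s == k) llin (xh s)).

Lemma gD_val i : gD n lam mu x p i = lmap v (gS i).
Proof.
rewrite !lmap_lmul !lmap_lprod; congr (lmul (lmul _ _) _).
- by apply: eq_big_seq => r rin; rewrite lmap_llin /= v_ph.
- by apply: eq_big_seq => r rin; rewrite lmap_linvlin val_ph1.
apply: eq_bigr => k _; rewrite lmap_lprod; apply: eq_bigr => s _.
by rewrite lmap_llin /= v_xh.
Qed.

Definition fcoefS al i c : S :=
  let r := rk i c in
  (Ps al).[ph al.-1 (r al.-1) + 1]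
  * (\prod_(k <- iota i.+1 (al.-1 - i)) (Px k (r k)).[ph k.-1 (r k.-1) + 1])
  * (\prod_(k <- iota i (al - i)) (Px k (r k)).[ph k (r k)])^-1.

(* [ecoef] without its leading factor [Pev], which is the only one involving level [i.-1]. *)
Definition ecoreS i be c : S :=
  let r := rk i c in
  (\prod_(k <- iota i (be.-1 - i)) (Px k (r k)).[ph k.+1 (r k.+1) - 1])
  * (\prod_(k <- iota i (be - i)) (Px k (r k)).[ph k (r k)])^-1
  * (\prod_(k <- iota i (be - i)) (Zs k).[ph k (r k)]).

Lemma prodPx_unit i len c : c \in chains a i len ->
  (\prod_(k <- iota i len) (Px k (rk i c k)).[ph k (rk i c k)]) \is a GRing.unit.
Proof.
move=> cin; rewrite big_seq; apply: (big_ind (fun w => w \is a GRing.unit)).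
- exact: unitr1.
- by move=> w1 w2 u1 u2; rewrite unitrM u1.
by move=> k; rewrite mem_iota => kin; apply/Px_unit/(rk_chains cin).
Qed.

Lemma fcoef_val al i c : (i < al)%N -> c \in chains a i (al - i) ->
  fcoef n lam mu p al i c = v (fcoefS al i c).
Proof.
move=> ial cin; have rkin k : (i <= k < al)%N -> rk i c k \in lev k.
  by move=> ik; apply: (rk_chains cin); lia.
rewrite /fcoef /fcoefS 2!rmorphM rmorphV ?prodPx_unit // !rmorph_prod.
congr (_ * _ * _^-1).
- by rewrite val_ph1 ?Pev_val // rkin //; lia.
- apply: eq_big_seq => k; rewrite mem_iota => kin.
  by rewrite val_ph1 ?Prev_val // rkin //; lia.
apply: eq_big_seq => k; rewrite mem_iota => kin.
by rewrite -Prev_val v_ph // rkin //; lia.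
Qed.

Lemma ecoef_val i be c : (i < be)%N -> c \in chains a i (be - i) ->
  ecoef n lam mu x p i be c
  = v ((Ps i.-1).[ph i (rk i c i) - 1] * ecoreS i be c).
Proof.
move=> ibe cin; have rkin k : (i <= k < be)%N -> rk i c k \in lev k.
  by move=> ik; apply: (rk_chains cin); lia.
rewrite /ecoef /ecoreS !mulrA 3!rmorphM rmorphV ?prodPx_unit // !rmorph_prod.
congr (_ * _ * _^-1 * _).
- by rewrite val_phB1 ?Pev_val // rkin //; lia.
- apply: eq_big_seq => k; rewrite mem_iota => kin.
  by rewrite val_phB1 ?Prev_val // rkin //; lia.
- apply: eq_big_seq => k; rewrite mem_iota => kin.
  by rewrite -Prev_val v_ph // rkin //; lia.
apply: eq_big_seq => k; rewrite mem_iota => kin.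
by rewrite -Zev_val v_ph // rkin //; lia.
Qed.

(* [F_{j,r}] and [E_{j,r}] of the header. *)
Definition FS al j r : A := \sum_(c <- chains a j.+1 (al - j.+1))
  fcoef n lam mu p al j (r :: c) * fexp eqm al j (r :: c).

Definition ES be j r : A := \sum_(c <- chains a j.+1 (be - j.+1))
  v (ecoreS j be (r :: c)) * eexp eqp j be (r :: c).

(** * Recursion on the first entry of a chain *)

Lemma chains_cons j al r c : (j < al)%N -> r \in lev j ->
  c \in chains a j.+1 (al - j.+1) -> r :: c \in chains a j (al - j).
Proof.
move=> jal rin cin; rewrite -(subnSK jal) /=.
by apply: allpairs_f_dep.
Qed.

Lemma big_chains j al (F : seq nat -> A) : (j < al)%N ->
  \sum_(c <- chains a j (al - j)) F c
  = \sum_(r <- lev j) \sum_(c <- chains a j.+1 (al - j.+1)) F (r :: c).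
Proof. by move=> jal; rewrite -(subnSK jal) /= big_allpairs_dep. Qed.

Lemma prod_iota_cons (G1 G2 : nat -> S) j len :
  (forall k, (j < k)%N -> G1 k = G2 k) ->
  \prod_(k <- iota j len.+1) G1 k = G1 j * \prod_(k <- iota j.+1 len) G2 k.
Proof.
move=> G12; rewrite big_cons; congr (_ * _).
by apply: eq_big_seq => k; rewrite mem_iota => /andP[/G12].
Qed.

Lemma prodPx_cons al j r c : (j < al)%N -> r \in lev j ->
    c \in chains a j.+1 (al - j.+1) ->
  (\prod_(k <- iota j (al - j)) (Px k (rk j (r :: c) k)).[ph k (rk j (r :: c) k)])^-1
  = (\prod_(k <- iota j.+1 (al - j.+1)) (Px k (rk j.+1 c k)).[ph k (rk j.+1 c k)])^-1
    * (Px j r).[ph j r]^-1.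
Proof.
move=> jal rin cin; rewrite -(subnSK jal).
rewrite (@prod_iota_cons _ (fun k => (Px k (rk j.+1 c k)).[ph k (rk j.+1 c k)])).
  by rewrite rk_head invrM ?Px_unit ?prodPx_unit.
by move=> k jk; rewrite rk_cons.
Qed.

(** The factor gained by prepending [r] depends on [c] only through its head. This is why sums over
    chains satisfy a linear recursion between adjacent levels. *)
Lemma fcoefS_cons al j r c : (j.+1 < al)%N -> r \in lev j ->
    c \in chains a j.+1 (al - j.+1) ->
  fcoefS al j (r :: c) = fcoefS al j.+1 c
    * ((Px j.+1 (rk j.+1 c j.+1)).[ph j r + 1] * (Px j r).[ph j r]^-1).
Proof.
move=> jal rin cin; rewrite /fcoefS prodPx_cons //; last by lia.
have -> : (al.-1 - j = (al.-1 - j.+1).+1)%N by lia.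
rewrite (@prod_iota_cons _ (fun k =>
  (Px k (rk j.+1 c k)).[ph k.-1 (rk j.+1 c k.-1) + 1])); last first.
  by move=> k jk; rewrite !rk_cons //; lia.
rewrite [j.+1.-1]/= rk_head !rk_cons //; last by lia.
by ring.
Qed.

Lemma ecoreS_cons be j r c : (j.+1 < be)%N -> r \in lev j ->
    c \in chains a j.+1 (be - j.+1) ->
  ecoreS j be (r :: c) = ((Px j r).[ph j r]^-1 * (Zs j).[ph j r])
    * ((Px j r).[ph j.+1 (rk j.+1 c j.+1) - 1] * ecoreS j.+1 be c).
Proof.
move=> jbe rin cin; rewrite /ecoreS prodPx_cons //; last by lia.
have -> : (be.-1 - j = (be.-1 - j.+1).+1)%N by lia.
have -> : (be - j = (be - j.+1).+1)%N by lia.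
rewrite (@prod_iota_cons _ (fun k =>
  (Px k (rk j.+1 c k)).[ph k.+1 (rk j.+1 c k.+1) - 1])); last first.
  by move=> k jk; rewrite !rk_cons //; lia.
rewrite (@prod_iota_cons _ (fun k => (Zs k).[ph k (rk j.+1 c k)])); last first.
  by move=> k jk; rewrite !rk_cons.
by rewrite rk_head rk_cons //; ring.
Qed.

Lemma fexp_cons al j r c : (j < al)%N ->
  fexp eqm al j (r :: c) = eqm j r * fexp eqm al j.+1 c.
Proof.
move=> jal; rewrite /fexp -(subnSK jal) /= big_cons rk_head; congr (_ * _).
by apply: eq_big_seq => k; rewrite mem_iota => kin; rewrite rk_cons //; lia.
Qed.

Lemma eexp_cons be j r c : (j < be)%N ->
  eexp eqp j be (r :: c) = eqp j r * eexp eqp j.+1 be c.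
Proof.
move=> jbe; rewrite /eexp -(subnSK jbe) /= big_cons rk_head; congr (_ * _).
by apply: eq_big_seq => k; rewrite mem_iota => kin; rewrite rk_cons //; lia.
Qed.

Lemma comm_fexp u al j c : c \in chains a j (al - j) ->
  (forall k, (j <= k < al)%N -> GRing.comm u (eqm k (rk j c k))) ->
  GRing.comm u (fexp eqm al j c).
Proof.
move=> cin uk; rewrite /fexp big_seq; apply: commr_prod => k.
by rewrite mem_iota => kin; apply: uk; lia.
Qed.

Lemma eqm_eqm i r j s : r \in lev i -> s \in lev j -> GRing.comm (eqm i r) (eqm j s).
Proof. by rewrite !lev_ok => ir js; have [] := e_comm ir js. Qed.

(* [FS] and [ES] with the factors of level [j] that do not involve level [j.+1] split off,
   see [FSE] and [ESE]; what is left is linear in [FS] resp. [ES] at level [j.+1]. *)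
Definition Lft al j r : A :=
  if j.+1 == al then v (Ps al).[ph j r + 1]
  else \sum_(r' <- lev j.+1) FS al j.+1 r' * v (Px j.+1 r').[ph j r + 1].

Definition Rgt be j r : A :=
  if j.+1 == be then 1
  else \sum_(s <- lev j.+1) v (Px j r).[ph j.+1 s - 1] * ES be j.+1 s.

Lemma FSE al j r : (j < al)%N -> r \in lev j ->
  FS al j r = Lft al j r * v ((Px j r).[ph j r])^-1 * eqm j r.
Proof.
move=> jal rin; rewrite /FS /Lft; case: eqP => [<-|/eqP jal'].
  rewrite subnn big_seq1 fcoef_val //; last by apply: chains_cons; rewrite ?subnn.
  rewrite fexp_cons // /fexp subnn big_nil mulr1 /fcoefS [j.+1.-1]/= subnn subSnn.
  by rewrite big_nil big_seq1 !rk_head mulr1 rmorphM.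
have {jal'}jal' : (j.+1 < al)%N by lia.
rewrite big_chains // !mulr_suml; apply: eq_big_seq => r' r'in.
rewrite !mulr_suml big_seq [RHS]big_seq; apply: eq_bigr => c cin.
have c'in := chains_cons jal' r'in cin.
rewrite !fcoef_val //; last exact: chains_cons.
rewrite fcoefS_cons // rk_head fexp_cons //.
rewrite (rmorphM v (fcoefS _ _ _)) (rmorphM v (Px _ _).[_]).
have rkin k : (j.+1 <= k < al)%N -> rk j.+1 (r' :: c) k \in lev k.
  by move=> ik; apply: (rk_chains c'in); lia.
(* The exponential of level [j.+1] shifts only [ph j.+1 r'], which [Px j.+1 r'] omits; the
   exponentials of higher levels shift nothing that occurs here. *)
have cX : GRing.comm (v (Px j.+1 r').[ph j r + 1] * v (Px j r).[ph j r]^-1)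
                     (fexp eqm al j.+1 (r' :: c)).
  apply: comm_fexp => // k kin; apply: commr_sym.
  have cw : GRing.comm (eqm k (rk j.+1 (r' :: c) k)) (v (ph j r)).
    by rewrite v_ph //; apply: eqm_comm; rewrite ?rkin //; lia.
  apply: commrM.
    apply: comm_Px => [s sin nsr|]; last by rewrite rmorphD rmorph1; apply: commrD (commr1 _).
    apply: eqm_comm; rewrite ?rkin //.
    by apply/negP => /andP[/eqP kj /eqP]; rewrite kj rk_head => /eqP; rewrite eq_sym (negbTE nsr).
  rewrite rmorphV ?Px_unit //; apply: commrV; apply: comm_Px => // s sin _.
  by apply: eqm_comm; rewrite ?rkin //; lia.
have ce : GRing.comm (eqm j r) (fexp eqm al j.+1 (r' :: c)).
  by apply: comm_fexp => // k kin; apply: eqm_eqm; rewrite ?rkin.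
by rewrite ce mulrA -(mulrA _ (v _ * v _)) cX !mulrA.
Qed.

Lemma comm_ecoreS u be j c : (j < be)%N -> c \in chains a j (be - j) ->
  (forall k s, (j <= k < be)%N -> s \in lev k -> GRing.comm u (p k s)) ->
  GRing.comm u (v (ecoreS j be c)).
Proof.
move=> jbe cin uk; have rkin k : (j <= k < be)%N -> rk j c k \in lev k.
  by move=> ik; apply: (rk_chains cin); lia.
have uph k : (j <= k < be)%N -> GRing.comm u (v (ph k (rk j c k))).
  by move=> kin; rewrite v_ph ?rkin //; apply: uk; rewrite ?rkin.
rewrite /ecoreS 2!rmorphM rmorphV ?prodPx_unit // !rmorph_prod.
apply: commrM; first apply: commrM.
- rewrite big_seq; apply: commr_prod => k; rewrite mem_iota => kin.
  apply: comm_Px => [s sin _|]; first by apply: uk => //; lia.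
  by rewrite rmorphB rmorph1; apply: commrB (commr1 _); apply: uph; lia.
- apply: commrV; rewrite big_seq; apply: commr_prod => k; rewrite mem_iota => kin.
  by apply: comm_Px => [s sin _|]; [apply: uk => //; lia | apply: uph; lia].
rewrite big_seq; apply: commr_prod => k; rewrite mem_iota => kin.
by apply: comm_Zs; apply: uph; lia.
Qed.

(** Mirror image of [FSE]: [eqp j s] moves left, since [Px j s] omits [ph j s] and [ecoreS j.+1]
    involves only levels above [j]. *)
Lemma ESE be j s : (j < be)%N -> s \in lev j ->
  ES be j s = v ((Px j s).[ph j s]^-1 * (Zs j).[ph j s]) * eqp j s * Rgt be j s.
Proof.
move=> jbe sin; rewrite /ES /Rgt; case: eqP => [<-|/eqP jbe'].
  rewrite subnn big_seq1 eexp_cons // /eexp subnn big_nil !mulr1 /ecoreS [j.+1.-1]/=.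
  by rewrite subnn subSnn big_nil !big_seq1 !rk_head mul1r.
have {jbe'}jbe' : (j.+1 < be)%N by lia.
rewrite big_chains // mulr_sumr; apply: eq_big_seq => s' s'in.
rewrite 2!mulr_sumr big_seq [RHS]big_seq; apply: eq_bigr => c cin.
have c'in := chains_cons jbe' s'in cin.
rewrite ecoreS_cons // rk_head eexp_cons // (rmorphM v (_^-1 * _)) (rmorphM v (Px _ _).[_]).
have cX : GRing.comm (eqp j s) (v (Px j s).[ph j.+1 s' - 1] * v (ecoreS j.+1 be (s' :: c))).
  apply: commrM.
    apply: comm_Px => [t tin nts|].
      by apply: eqp_comm => //; rewrite eqxx eq_sym (negbTE nts).
    by rewrite rmorphB rmorph1 v_ph //; apply: commrB (commr1 _); apply: eqp_comm => //; lia.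
  by apply: comm_ecoreS => // k t kin tin; apply: eqp_comm => //; lia.
by rewrite -[LHS]mulrA (mulrA (_ * _) (eqp _ _)) -cX !mulrA.
Qed.

(** Among the exponentials of the chain only [eqm j r] shifts [p j r]. Hence the pole of [fD] at
    [p j r + 1] becomes a pole at [p j r] once the exponentials stand to its left. *)
Lemma fexp_shift al j r c : (j < al)%N -> r \in lev j ->
    c \in chains a j.+1 (al - j.+1) ->
  (p j r + 1) * fexp eqm al j (r :: c) = fexp eqm al j (r :: c) * p j r.
Proof.
move=> jal rin cin; rewrite fexp_cons // mulrA -eqm_shift // -!mulrA; congr (_ * _).
have [jal'|jal'] := ltnP j.+1 al; last first.
  by rewrite /fexp (eqP (_ : al - j.+1 == 0)%N) ?big_nil ?mulr1 ?mul1r ?subn_eq0.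
apply: comm_fexp => // k kin; apply: commr_sym; apply: eqm_comm => //.
  by apply: (rk_chains cin); lia.
by apply/negP; lia.
Qed.

(** * Factoring the summands of [TD] through [FS], [gS] and [ES] *)

Lemma lcoef_fD_mul al i t k : (i < al)%N ->
  lcoef (lmul (fD n lam mu p eqm al i) t) k
  = \sum_(r <- lev i) FS al i r * lcoef (lmul (linvlin (p i r)) t) k.
Proof.
move=> ial; rewrite /fD ltn_eqF // lcoef_lsum_mull big_chains //.
apply: eq_big_seq => r rin; rewrite /FS mulr_suml big_seq [RHS]big_seq.
apply: eq_bigr => c cin; rewrite rk_head -(lmulA (lconst _)).
by rewrite (linvlin_comm_const (fexp_shift _ _ _)) // lmulA lmul_lconst -lmulA lcoef_lconstl.
Qed.

Lemma lcoef_mul_eD be i t k : (i < be)%N ->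
  lcoef (lmul t (eD n lam mu x p eqp i be)) k
  = - \sum_(s <- lev i) lcoef (lmul t (linvlin (p i s))) k
        * v (Ps i.-1).[ph i s - 1] * ES be i s.
Proof.
move=> ibe; rewrite /eD ltn_eqF // lmul_lopp lcoef_lopp lcoef_lsum_mulr big_chains //.
congr (- _); apply: eq_big_seq => s sin; rewrite /ES mulr_sumr big_seq [RHS]big_seq.
apply: eq_bigr => c cin; have cin' := chains_cons ibe sin cin.
rewrite rk_head ecoef_val // rk_head.
rewrite -(@linvlin_comm_const _ (p i s)); last by rewrite -v_ph // -!rmorphM mulrC.
by rewrite -lmulA lmul_lconst lmulA lcoef_lconstr rmorphM !mulrA.
Qed.

Lemma lcoef_Zlt (i : nat) (W : lser S) k :
  lcoef (lmul (\lprod_(k <- iota 0 i)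
     \lprod_(s <- iota 1 (lam 1%N) | idx n lam s == k) llin (xh s)) W) k
  = pact (Zlt i) (lcoef W) k.
Proof.
rewrite /Zlt; elim/big_rec2: _ k => [|l Q t _ IH] k; first by rewrite lmul1l pactC mul1r.
by rewrite -lmulA lcoef_lprod_llinM pactM; apply: eq_pact.
Qed.

Local Notation V j := (\lprod_(t <- lev j) linvlin (ph j t + 1)).

(** The pole at [ph i r] cancels one linear factor of [P_i]; the numerator that remains is a
    polynomial and acts on the other poles. *)
Lemma lcoef_gS_mul i r W k : r \in lev i ->
  lcoef (lmul (lmul (linvlin (ph i r)) (gS i)) W) k
  = pact (Px i r * Zlt i) (lcoef (lmul (V i.-1) W)) k.
Proof.
move=> rin; rewrite /gS (bigD1_seq r) ?iota_uniq //=.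
set X := \big[_/_]_(s <- _ | _) _; set Z := \big[_/_]_(k <- iota 0 i) _.
have -> : lmul (lmul (linvlin (ph i r))
      (lmul (lmul (lmul (llin (ph i r)) X) (V i.-1)) Z)) W
    = lmul X (lmul Z (lmul (V i.-1) W)).
  rewrite -!lmulA (lmulA (linvlin _)) (lmulC (linvlin _)) llin_linvlin lmul1l.
  by congr lmul; rewrite lmulA (lmulC _ Z) -lmulA.
rewrite lcoef_lprod_llinM pactM; apply: eq_pact => l; exact: lcoef_Zlt.
Qed.

Lemma lcoef_gS i k : lcoef (gS i) k = pact (Ps i * Zlt i) (lcoef (V i.-1)) k.
Proof.
rewrite /gS -lmulA lcoef_lprod_llinM pactM; apply: eq_pact => l.
by rewrite lmulC lcoef_Zlt.
Qed.

Lemma horner_shift j (P : pred nat) (w : S) :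
  (\prod_(t <- lev j | P t) ('X - (ph j t + 1)%:P)).[w]
  = (\prod_(t <- lev j | P t) ('X - (ph j t)%:P)).[w - 1].
Proof.
rewrite !horner_prod; apply: eq_bigr => t _; rewrite !hornerXsubC; ring.
Qed.

Lemma ph1_unit j :
  {in lev j &, forall r s, r != s -> (ph j r + 1) - (ph j s + 1) \is a GRing.unit}.
Proof. by move=> r s rin sin nrs; rewrite opprD addrACA subrr addr0 ph_unit. Qed.

(** * Residues between two adjacent levels *)

Section Residues.
Variables (j kk : nat).

(* Coefficients of [z ^ (- kk - 1)]: [wt] comes from the pole of [1 / P_j (z - 1)] at
   [ph j t + 1], and [mid] is the remainder at level [j]; conjugation by [eqm j t] turns
   the latter into the former. *)
Definition wt t : S :=
  (Px j t).[ph j t]^-1 * (Zlt j.+1).[ph j t + 1] * (ph j t + 1) ^+ kk.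

Lemma pact_V Q : pact (Q * Zlt j.+1) (lcoef (V j)) (Negz kk)
  = \sum_(t <- lev j) Q.[ph j t + 1] * wt t.
Proof.
rewrite (partial_fractions (iota_uniq _ _) (@ph1_unit j)).
apply: eq_big_seq => t tin; rewrite hornerM horner_shift addrK /wt /Px.
by ring.
Qed.

(** This is [partial_fractions_pole] for the nodes [ph j t + 1] and [q = ph j.+1 s]. Its sum over
    the nodes cancels the sum over [t], and its value at [q] contains [(Px j.+1 r).[ph j.+1 s]],
    which vanishes unless [r = s]. *)
Lemma residue_inner r s : r \in lev j.+1 -> s \in lev j.+1 ->
  lcoef (lmul (lmul (linvlin (ph j.+1 r)) (gS j.+1)) (linvlin (ph j.+1 s))) (Negz kk)
    * (Ps j).[ph j.+1 s - 1]
  + \sum_(t <- lev j) (Px j.+1 r).[ph j t + 1] * wt t * (Px j t).[ph j.+1 s - 1]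
  = (r == s)%:R
    * ((Px j.+1 s).[ph j.+1 s] * (Zlt j.+1).[ph j.+1 s] * ph j.+1 s ^+ kk).
Proof.
move=> rin sin; rewrite lcoef_gS_mul // mulrC.
have := partial_fractions_pole (iota_uniq _ _) (@ph1_unit j)
  (Px j.+1 r * Zlt j.+1) (ph j.+1 s) kk.
rewrite (horner_shift j predT) -/(Ps j) => ->.
have -> : (Px j.+1 r * Zlt j.+1).[ph j.+1 s]
    = (r == s)%:R * ((Px j.+1 s).[ph j.+1 s] * (Zlt j.+1).[ph j.+1 s]).
  rewrite hornerM; case: eqP => [->|/eqP nrs]; first by rewrite mul1r.
  by rewrite (Px_root sin nrs) mulr0n !mul0r.
rewrite -addrA addrC [X in X + _ = _](_ : _ = 0) ?add0r ?mulrA //.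
rewrite addrC; apply/eqP; rewrite subr_eq0; apply/eqP; apply: eq_big_seq => t tin.
by rewrite !horner_shift addrK hornerM /wt /Px; ring.
Qed.

(** [P_(j+1)] cancels the pole at [ph j.+1 s]. Splitting [s] off [Ps j.+1] and [t] off [Ps j] then
    leaves the opposite factors [ph j t + 1 - ph j.+1 s] and [ph j.+1 s - 1 - ph j t]. *)
Lemma residue_row s : s \in lev j.+1 ->
  lcoef (lmul (gS j.+1) (linvlin (ph j.+1 s))) (Negz kk) * (Ps j).[ph j.+1 s - 1]
  + \sum_(t <- lev j) (Ps j.+1).[ph j t + 1] * wt t * (Px j t).[ph j.+1 s - 1] = 0.
Proof.
move=> sin; rewrite lmulC -[lmul _ _]lmul1r lcoef_gS_mul // lmul1r pact_V mulr_suml.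
rewrite -big_split big1_seq // => t /andP[_ tin] /=.
rewrite (PsE sin) (PsE tin) !hornerM !hornerXsubC; ring.
Qed.

Lemma residue_col r : r \in lev j.+1 ->
  lcoef (lmul (linvlin (ph j.+1 r)) (gS j.+1)) (Negz kk)
  = \sum_(t <- lev j) (Px j.+1 r).[ph j t + 1] * wt t.
Proof. by move=> rin; rewrite -[lmul _ _]lmul1r lcoef_gS_mul // lmul1r pact_V. Qed.

Lemma residue_diag :
  lcoef (gS j.+1) (Negz kk) = \sum_(t <- lev j) (Ps j.+1).[ph j t + 1] * wt t.
Proof. by rewrite lcoef_gS pact_V. Qed.

Definition mid t : S := (Px j t).[ph j t] * (Zlt j).[ph j t] * ph j t ^+ kk.

Lemma Zlt_S : Zlt j.+1 = Zlt j * Zs j.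
Proof. by rewrite /Zlt -addn1 iotaD big_cat big_seq1. Qed.

Lemma eqm_horner t : t \in lev j ->
  eqm j t * v (Zlt j.+1 * 'X^kk).[ph j t]
  = v (Zlt j.+1 * 'X^kk).[ph j t + 1] * eqm j t.
Proof.
(* The shift relation [K] is stable under products, so ['X] and the linear factors of [Zlt], whose
   roots are scalars, suffice. *)
move=> tin; pose K Q := eqm j t * v Q.[ph j t] = v Q.[ph j t + 1] * eqm j t.
have KM Q Q' : K Q -> K Q' -> K (Q * Q').
  by rewrite /K !hornerM !rmorphM mulrA => -> KQ'; rewrite -mulrA KQ' mulrA.
have K1 : K 1 by rewrite /K !hornerC rmorph1 mulr1 mul1r.
have KX : K 'X by rewrite /K !hornerX rmorphD rmorph1 v_ph // eqm_shift.
apply: (KM); last by elim: kk => [|l IH]; rewrite ?expr0 // exprS; apply: KM.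
apply: big_ind => // l _; apply: big_ind => // s _.
rewrite /K !hornerXsubC !rmorphB rmorphD rmorph1 v_ph // v_xh mulrBr eqm_shift //.
by rewrite mulrBl mulr_algl mulr_algr.
Qed.

(** By [FSE] and [ESE], [mid] stands between [eqm j t] and [eqp j t]. Moving [eqm j t] to the right
    shifts the argument by one, after which the two exponentials cancel. The inverse from [ESE] is
    absorbed by [mid]; the one from [FSE] stays in [wt]. *)
Lemma residue_outer al be t : (j < al)%N -> (j < be)%N -> t \in lev j ->
  FS al j t * v (mid t) * ES be j t = Lft al j t * v (wt t) * Rgt be j t.
Proof.
move=> jal jbe tin; rewrite FSE // ESE //.
have midE : mid t * ((Px j t).[ph j t]^-1 * (Zs j).[ph j t])
    = (Zlt j.+1 * 'X^kk).[ph j t].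
  rewrite hornerM hornerXn Zlt_S hornerM /mid.
  have -> y1 y2 y3 y4 : y1 * y2 * y3 * (y1^-1 * y4) = y1 / y1 * (y2 * y4 * y3) :> S by ring.
  by rewrite divrr ?Px_unit // mul1r.
rewrite !mulrA -(mulrA _ (v (mid t))) -rmorphM midE -(mulrA _ (eqm j t)) eqm_horner //.
rewrite !mulrA -(mulrA _ (eqm j t)); move: (tin); rewrite lev_ok => /e_inv[_ ->].
rewrite mulr1 -(mulrA (Lft _ _ _)) -rmorphM hornerM hornerXn; congr (_ * v _ * _).
by rewrite /wt mulrA.
Qed.

Lemma residue_outer_sum al be : (j < al)%N -> (j < be)%N ->
  \sum_(t <- lev j) FS al j t * v (mid t) * ES be j t
  = \sum_(t <- lev j) Lft al j t * v (wt t) * Rgt be j t.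
Proof. by move=> jal jbe; apply: eq_big_seq => t; apply: residue_outer. Qed.

End Residues.

(** Collects the sum over the lower level inside [v], where commutative identities apply, and keeps
    the noncommuting [F] and [E] outside. *)
Lemma sandwich (T I J : Type) (rT : seq T) (rI : seq I) (rJ : seq J)
    (F : I -> A) (E : J -> A) (X : I -> T -> S) (w : T -> S) (Y : T -> J -> S) :
  \sum_(t <- rT) (\sum_(r <- rI) F r * v (X r t)) * v (w t)
                  * (\sum_(s <- rJ) v (Y t s) * E s)
  = \sum_(r <- rI) \sum_(s <- rJ) F r * v (\sum_(t <- rT) X r t * w t * Y t s) * E s.
Proof.
rewrite (eq_bigr (fun t => \sum_(r <- rI) \sum_(s <- rJ) F r * v (X r t * w t * Y t s) * E s)).
  rewrite exchange_big; apply: eq_bigr => r _; rewrite exchange_big.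
  by apply: eq_bigr => s _; rewrite rmorph_sum mulr_sumr mulr_suml.
move=> t _; rewrite mulr_suml big_distrlr; apply: eq_bigr => r _.
by apply: eq_bigr => s _; rewrite /= !rmorphM !mulrA.
Qed.

(** * Summation of the terms over the levels *)

Local Notation term al be i := (lmul (lmul (fD n lam mu p eqm al i) (gD n lam mu x p i))
                                     (eD n lam mu x p eqp i be)).

Lemma lcoef_term al be i k : (i < al)%N -> (i < be)%N ->
  lcoef (term al be i) k
  = - \sum_(r <- lev i) \sum_(s <- lev i) FS al i r
      * v (lcoef (lmul (lmul (linvlin (ph i r)) (gS i)) (linvlin (ph i s))) k
             * (Ps i.-1).[ph i s - 1])
      * ES be i s.
Proof.
move=> ial ibe; rewrite lcoef_mul_eD // exchange_big; congr (- _).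
apply: eq_big_seq => s sin; rewrite -lmulA lcoef_fD_mul // !mulr_suml.
apply: eq_big_seq => r rin; rewrite rmorphM -lcoef_lmap 2!lmap_lmul !lmap_linvlin.
by rewrite !v_ph // -gD_val lmulA !mulrA.
Qed.

Lemma lcoef_term_row be i k : (i < be)%N ->
  lcoef (term i be i) k
  = - \sum_(s <- lev i)
      v (lcoef (lmul (gS i) (linvlin (ph i s))) k * (Ps i.-1).[ph i s - 1]) * ES be i s.
Proof.
move=> ibe; rewrite lcoef_mul_eD // /fD eqxx lmul1l; congr (- _).
apply: eq_big_seq => s sin; rewrite rmorphM -lcoef_lmap lmap_lmul lmap_linvlin.
by rewrite v_ph // -gD_val.
Qed.

Lemma lcoef_term_col al i k : (i < al)%N ->
  lcoef (term al i i) k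
  = \sum_(r <- lev i) FS al i r * v (lcoef (lmul (linvlin (ph i r)) (gS i)) k).
Proof.
move=> ial; rewrite /eD eqxx lmul1r lcoef_fD_mul //.
apply: eq_big_seq => r rin; rewrite -lcoef_lmap lmap_lmul lmap_linvlin.
by rewrite v_ph // -gD_val.
Qed.

Lemma lcoef_term_diag i k : lcoef (term i i i) k = v (lcoef (gS i) k).
Proof. by rewrite /eD /fD eqxx lmul1r lmul1l -lcoef_lmap gD_val. Qed.

Lemma big_iota1S (F : nat -> A) j :
  \sum_(i <- iota 1 j.+1) F i = \sum_(i <- iota 1 j) F i + F j.+1.
Proof. by rewrite -{1}(addn1 j) iotaD big_cat big_seq1. Qed.

Lemma lcoef_partial_sum al be j kk : (j < al)%N -> (j < be)%N ->
  \sum_(i <- iota 1 j) lcoef (term al be i) (Negz kk)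
  = - \sum_(r <- lev j) FS al j r * v (mid j kk r) * ES be j r.
Proof.
(* Level 0 is empty because [acoef] vanishes there. *)
elim: j => [|j IH] jal jbe; first by rewrite /acoef !big_nil oppr0.
rewrite big_iota1S IH; try lia.
rewrite residue_outer_sum; try lia.
(* The remainder of level [j] and the term [j.+1] are now both bilinear in [FS] and [ES] of level
   [j.+1]; [residue_inner] says that their matrices add up to a diagonal one. *)
rewrite /Lft /Rgt !ltn_eqF // sandwich lcoef_term // -opprD -big_split; congr (- _).
apply: eq_big_seq => r rin; rewrite -big_split.
rewrite (bigD1_seq r) ?iota_uniq //= [X in _ + X]big1_seq ?addr0.
  rewrite -mulrDl -mulrDr -rmorphD addrC residue_inner // eqxx mul1r.
  by [].
move=> s /andP[nsr sin]; rewrite -mulrDl -mulrDr -rmorphD addrC residue_inner //.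
by rewrite eq_sym (negbTE nsr) mulr0n mul0r rmorph0 mulr0 mul0r.
Qed.

(** In the last term, with index [minn al be], at least one of [fD] and [eD] is 1. Its residues
    match the remainder of the level below by [residue_row], [residue_col] or [residue_diag],
    according to how [al] and [be] compare. *)
Lemma TD_regular al be kk : (0 < al)%N -> (0 < be)%N ->
  lcoef (TD n lam mu x p eqp eqm al be) (Negz kk) = 0.
Proof.
move=> al0 be0; rewrite /TD lcoef_lsum.
have [j jE] : exists j, minn al be = j.+1 by exists (minn al be).-1; lia.
rewrite jE big_iota1S.
have [jal jbe] : (j < al)%N /\ (j < be)%N by lia.
rewrite lcoef_partial_sum //.
rewrite residue_outer_sum // /Lft /Rgt.
have [lt|lt|eq] := ltngtP al be.
- have -> : al = j.+1 by lia.
  have jbe' : (j.+1 < be)%N by lia.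
  rewrite eqxx ltn_eqF // lcoef_term_row // -opprD; apply/eqP; rewrite oppr_eq0; apply/eqP.
  (* [Lft] is a single value here, so the sum over [r] is replaced by a sum over the one-element
     list [[:: tt]]. *)
  have := sandwich (lev j) [:: tt] (lev j.+1) (fun=> 1) (ES be j.+1)
    (fun _ t => (Ps j.+1).[ph j t + 1]) (wt j kk) (fun t s => (Px j t).[ph j.+1 s - 1]).
  rewrite big_seq1; under eq_bigr do rewrite big_seq1 mul1r.
  move=> ->; rewrite -big_split big1_seq // => s /andP[_ sin].
  by rewrite /= mul1r -mulrDl -rmorphD addrC residue_row // rmorph0 mul0r.
- have -> : be = j.+1 by lia.
  have jal' : (j.+1 < al)%N by lia.
  rewrite eqxx ltn_eqF // lcoef_term_col //.
  have := sandwich (lev j) (lev j.+1) [:: tt] (FS al j.+1) (fun=> 1)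
    (fun r t => (Px j.+1 r).[ph j t + 1]) (wt j kk) (fun _ _ => 1).
  under eq_bigr do rewrite big_seq1 rmorph1 mulr1.
  under [X in X = _]eq_bigr do rewrite mulr1.
  move=> Es; under eq_bigr do rewrite mulr1; rewrite Es.
  rewrite addrC; apply/eqP; rewrite subr_eq0; apply/eqP; apply: eq_big_seq => r rin.
  rewrite big_seq1 mulr1 residue_col //; congr (_ * v _).
  by apply: eq_bigr => t _; rewrite mulr1.
rewrite -eq in jE *; have -> : al = j.+1 by lia.
rewrite eqxx lcoef_term_diag residue_diag rmorph_sum addrC.
apply/eqP; rewrite subr_eq0; apply/eqP; apply: eq_bigr => t _.
by rewrite mulr1 rmorphM.
Qed.

(** * Coefficients of nonnegative powers *)

Lemma ldeg_gD i : ldeg (gD n lam mu x p i)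
  = (a i)%:Z - (a i.-1)%:Z
    + \sum_(k <- iota 0 i) \sum_(s <- iota 1 (lam 1%N) | idx n lam s == k) 1.
Proof.
rewrite /gD /lmul /ldeg -!/(ldeg _) !ldeg_lprod; congr (_ + _ + _).
- by rewrite big_const_seq count_predT size_iota iter_addr_0 [ldeg _]/= natz.
- by rewrite big_const_seq count_predT size_iota iter_addr_0 mulNrn natz.
by apply: eq_bigr => k _; rewrite ldeg_lprod.
Qed.

Lemma lcf0_gD i : lcf (gD n lam mu x p i) 0 = 1.
Proof.
have mul1 (s t : lser A) : lcf s 0 = 1 -> lcf t 0 = 1 -> lcf (lmul s t) 0 = 1.
  by move=> s1 t1; rewrite lcf_lmulE big_ord1 s1 t1 mulr1.
apply: (mul1); first apply: mul1.
- by apply: lcf0_lprod => r _; apply: lcf_llin.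
- by apply: lcf0_lprod.
by apply: lcf0_lprod => k _; apply: lcf0_lprod => s _; apply: lcf_llin.
Qed.

(** All factors have leading coefficient 1, so their next coefficients add up. *)
Lemma lcf1_gD i : lcf (gD n lam mu x p i) 1
  = \sum_(r <- lev i.-1) (p i.-1 r + 1) - \sum_(r <- lev i) p i r
    - \sum_(k <- iota 0 i) \sum_(s <- iota 1 (lam 1%N) | idx n lam s == k) (x s)%:A.
Proof.
have l0 (b : A) : lcf (llin b) 0 = 1 by apply: lcf_llin.
have P0 : lcf (Pser n lam mu p i) 0 = 1 by apply: lcf0_lprod.
have V0 : lcf (\lprod_(r <- lev i.-1) linvlin (p i.-1 r + 1)) 0 = 1.
  exact: lcf0_lprod.
have Z0 k : lcf (Zser n lam x A k) 0 = 1 by apply: lcf0_lprod.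
have ZZ0 : lcf (\lprod_(k <- iota 0 i) Zser n lam x A k) 0 = 1 by apply: lcf0_lprod.
rewrite /gD lcf1_lmul //; last by rewrite lcf_lmulE big_ord1 P0 V0 mulr1.
rewrite lcf1_lmul // !lcf1_lprod //; congr (_ + _).
  rewrite [RHS]addrC; congr (_ + _).
  by rewrite -sumrN; apply: eq_bigr => r _; rewrite lcf_llin.
rewrite -sumrN; apply: eq_bigr => k _; rewrite lcf1_lprod //.
by rewrite -sumrN; apply: eq_bigr => s _; rewrite lcf_llin.
Qed.

(** [fD] and [eD] contribute one simple pole each, which brings the degree down to at most -1. *)
Lemma lcoef_term0 al be i (k : nat) : (i < al)%N -> (i < be)%N ->
  ldeg (gD n lam mu x p i) <= 1 -> lcoef (term al be i) k%:Z = 0.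
Proof.
move=> ial ibe d1; rewrite lcoef_mul_eD // big1 ?oppr0 // => s _.
rewrite -lmulA lcoef_fD_mul // big1 ?mul0r // => r _.
rewrite lcoef_eq0 ?mulr0 //.
have -> g : ldeg (lmul (linvlin (p i r)) (lmul g (linvlin (p i s)))) = -1 + (ldeg g - 1) by [].
by move: d1; set d := ldeg _; lia.
Qed.

Lemma lcoef_TD al be j (k : nat) : minn al be = j.+1 ->
  (forall i, (0 < i <= j)%N -> ldeg (gD n lam mu x p i) <= 1) ->
  lcoef (TD n lam mu x p eqp eqm al be) k%:Z = lcoef (term al be j.+1) k%:Z.
Proof.
move=> jE d1; rewrite /TD lcoef_lsum jE big_iota1S big1_seq ?add0r // => i /=.
rewrite mem_iota => iin; apply: lcoef_term0; try lia.
by apply: d1; lia.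
Qed.

Lemma lcoef_lead (s : lser A) (k : nat) : ldeg s <= k%:Z ->
  lcoef s k%:Z = if ldeg s == k%:Z then lcf s 0 else 0.
Proof.
rewrite /lcoef; case: eqP => [->|dk sk]; first by rewrite subrr.
by case E: (_ - _) => [[|j]|j] //; lia.
Qed.

(** * Entries of [TD] from the degree of [gD] *)

Section Degree.
Variable i : nat.
Hypothesis i_gt0 : (0 < i)%N.
Hypothesis deg_le1 : forall l, (0 < l <= i)%N -> ldeg (gD n lam mu x p l) <= 1.
Let deg_i : ldeg (gD n lam mu x p i) <= 1.
Proof. by apply: deg_le1; rewrite i_gt0 /=. Qed.

Lemma lcoef_TD_last al be (k : nat) : minn al be = i ->
  lcoef (TD n lam mu x p eqp eqm al be) k%:Z = lcoef (term al be i) k%:Z.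
Proof.
move=> iE; have jE : minn al be = i.-1.+1 by rewrite prednK.
by rewrite (lcoef_TD _ jE) ?prednK // => l lin; apply: deg_le1; lia.
Qed.

(** One pole lowers the degree to at most 0 and keeps the leading coefficient 1; this makes the
    entries right of the diagonal constant. *)
Lemma lcoef_gD_inv (k : nat) (b : A) : 
  lcoef (lmul (gD n lam mu x p i) (linvlin b)) k%:Z
  = ((ldeg (gD n lam mu x p i) == 1) && (k == 0))%:R.
Proof.
have dE : ldeg (lmul (gD n lam mu x p i) (linvlin b)) = ldeg (gD n lam mu x p i) - 1 by [].
rewrite lcoef_lead dE; last by move: deg_i; set d := ldeg _; lia.
rewrite lcf_lmulE big_ord1 lcf0_gD mulr1.
by move: deg_i; set d := ldeg _ => d1; do 2!case: eqP; case: eqP => //=; lia.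
Qed.

Lemma lcoef_inv_gD (k : nat) (b : A) : 
  lcoef (lmul (linvlin b) (gD n lam mu x p i)) k%:Z
  = ((ldeg (gD n lam mu x p i) == 1) && (k == 0))%:R.
Proof.
have dE : ldeg (lmul (linvlin b) (gD n lam mu x p i)) = -1 + ldeg (gD n lam mu x p i) by [].
rewrite lcoef_lead dE; last by move: deg_i; set d := ldeg _; lia.
rewrite lcf_lmulE big_ord1 lcf0_gD mulr1.
by move: deg_i; set d := ldeg _ => d1; do 2!case: eqP; case: eqP => //=; lia.
Qed.

Lemma TD_row be : (i < be)%N ->
  lser_eq (TD n lam mu x p eqp eqm i be)
    (lconst (if ldeg (gD n lam mu x p i) == 1 then Tup n lam mu x p eqp i be else 0)).
Proof.
move=> ibe [k|k]; last by rewrite TD_regular ?lcoef_lconst //; lia.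
rewrite lcoef_TD_last; last by lia.
rewrite lcoef_mul_eD // /fD eqxx lmul1l lcoef_lconst.
under eq_bigr do rewrite lcoef_gD_inv.
case: eqP => _ /=; last by rewrite big1 ?oppr0 ?if_same // => s _; rewrite !mul0r.
case: k => [|k] /=; last by rewrite big1 ?oppr0 // => s _; rewrite !mul0r.
rewrite /Tup big_chains //; congr (- _); apply: eq_big_seq => s sin.
rewrite mul1r /ES mulr_sumr big_seq [RHS]big_seq; apply: eq_bigr => c cin.
by rewrite ecoef_val ?chains_cons // rk_head (rmorphM v (Ps _).[_]) mulrA.
Qed.

Lemma TD_col al : (i < al)%N ->
  lser_eq (TD n lam mu x p eqp eqm al i)
    (lconst (if ldeg (gD n lam mu x p i) == 1 then Tlow n lam mu p eqm al i else 0)).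
Proof.
move=> ial [k|k]; last by rewrite TD_regular ?lcoef_lconst //; lia.
rewrite lcoef_TD_last; last by lia.
rewrite /eD eqxx lmul1r lcoef_fD_mul // lcoef_lconst.
under eq_bigr do rewrite lcoef_inv_gD.
case: eqP => _ /=; last by rewrite big1 ?if_same // => s _; rewrite !mulr0.
case: k => [|k] /=; last by rewrite big1 // => s _; rewrite !mulr0.
by rewrite /Tlow big_chains //; apply: eq_bigr => r _; rewrite mulr1.
Qed.

Lemma TD_diag1 : ldeg (gD n lam mu x p i) = 1 ->
  lser_eq (TD n lam mu x p eqp eqm i i) (ladd lz (lconst (lcf (gD n lam mu x p i) 1))).
Proof.
move=> d1 [k|k]; rewrite lcoef_ladd lcoef_lconst; last first.
  by rewrite TD_regular // (@lcoefE _ _ _ k.+2) ?addr0 //= NegzE opprK -PoszD.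
rewrite lcoef_TD_last ?minnn // /eD /fD eqxx lmul1r lmul1l.
case: k => [|[|k]].
- by rewrite (@lcoefE _ (gD _ _ _ _ _ _) _ 1) ?d1 // (@lcoefE _ lz _ 1) //= add0r.
- rewrite (@lcoefE _ (gD _ _ _ _ _ _) _ 0) ?d1 // (@lcoefE _ lz _ 0) //.
  by rewrite lcf0_gD addr0.
by rewrite !lcoef_eq0 ?d1 ?addr0.
Qed.

Lemma TD_diag0 : ldeg (gD n lam mu x p i) <= 0 ->
  lser_eq (TD n lam mu x p eqp eqm i i)
    (lconst (if ldeg (gD n lam mu x p i) == 0 then 1 else 0)).
Proof.
move=> d0 [k|k]; rewrite lcoef_lconst; last by rewrite TD_regular //.
rewrite lcoef_TD_last ?minnn // /eD /fD eqxx lmul1r lmul1l lcoef_lead; last by lia.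
by rewrite lcf0_gD; case: k => [|k] //; rewrite lt_eqF //; lia.
Qed.

End Degree.

End Lax.

(** * Combinatorics of [lam] and [mu] *)

(** Monotonicity of [mu] makes the conditions defining [mIdx] and [mIdx'] downward closed, so
    comparison with these maxima amounts to testing the condition. *)
Lemma bigmax_downset (n : nat) (P : pred nat) i :
    (forall j k, (1 <= j <= k)%N -> (k <= n)%N -> P k -> P j) -> (1 <= i <= n)%N ->
  (i <= \max_(1 <= j < n.+1 | P j) j)%N = P i.
Proof.
move=> Pdown iin; apply/idP/idP => [|Pi]; last first.
  by apply: (@leq_bigmax_seq _ _ _ id) Pi; rewrite mem_index_iota; lia.
apply: contraTT => nPi; have i0 : (0 < i)%N by case/andP: iin.
rewrite -ltnNge -(prednK i0) ltnS; apply/bigmax_leqP_seq => j; rewrite mem_index_iota => jin Pj.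
rewrite leqNgt; apply/negP => ij; case/negP: nPi.
by apply: (Pdown i j) Pj; lia.
Qed.

Lemma sum_pred1_uniq (T : eqType) (V : nmodType) (r : seq T) i (F : T -> V) :
  uniq r -> i \in r -> \sum_(j <- r | i == j) F j = F i.
Proof.
move=> ur ir; rewrite -big_filter (@eq_filter _ _ (pred1 i)) => [|j].
  by rewrite filter_pred1_uniq // big_seq1.
by rewrite /= eq_sym.
Qed.

Lemma sum_idx_lt n lam (V : nmodType) (F : nat -> V) i :
  \sum_(k <- iota 0 i) \sum_(s <- iota 1 (lam 1%N) | idx n lam s == k) F s
  = \sum_(s <- iota 1 (lam 1%N) | (idx n lam s < i)%N) F s.
Proof.
under eq_bigr do rewrite big_mkcond.
rewrite exchange_big [RHS]big_mkcond; apply: eq_bigr => s _.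
rewrite -big_mkcond; case: ltnP => si.
  by rewrite sum_pred1_uniq ?iota_uniq ?mem_iota.
rewrite big_seq_cond big_pred0 // => k; rewrite mem_iota.
by apply/negP => /andP[kin /eqP ks]; move: si; rewrite ks; lia.
Qed.

(** The [i]-th coordinate of [varpi j] is -1 exactly when [j < i]. Exchanging the sums undoes the
    grouping by values, as each [s] contributes to exactly one [y]. *)
Lemma epsxE n lam (x : nat -> CC) i :
  epsx n lam x i = - \sum_(s <- iota 1 (lam 1%N) | (idx n lam s < i)%N) x s.
Proof.
rewrite /epsx /lambda_at.
under eq_bigr do rewrite rmorph_sum mulr_suml big_mkcond.
rewrite exchange_big [in RHS]big_mkcond -sumrN; apply: eq_big_seq => s sin.
rewrite -big_mkcond sum_pred1_uniq ?undup_uniq ?mem_undup ?map_f //.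
  by rewrite /varpi; case: ifP => _; rewrite ?rmorphN ?mulN1r ?mul0r ?oppr0.
Qed.

Lemma lcf1_gD_Tdiag n lam mu (x : nat -> CC) (A : unitAlgType CC)
    (p : nat -> nat -> A) i :
  lcf (gD n lam mu x p i) 1 = Tdiag n lam mu x p i.
Proof.
rewrite lcf1_gD sum_idx_lt /Tdiag epsxE scaleNr scaler_suml; congr (_ - _).
Qed.

Section MuIndices.
Variables (n : nat) (mu : nat -> int).
Hypothesis mu_step : forall j, (1 <= j < n)%N -> mu j.+1 <= mu j.

Lemma mu_anti j k : (1 <= j <= k)%N -> (k <= n)%N -> mu k <= mu j.
Proof.
elim: k => [|k IH] jk kn; first by lia.
have [->//|ne] := eqVneq j k.+1.
by apply: le_trans (IH _ _); [apply: mu_step|..]; lia.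
Qed.

Lemma leq_mIdx' i : (1 <= i <= n)%N -> (i <= mIdx' n mu)%N = (mu (n - i + 1)%N <= 0).
Proof.
apply: (@bigmax_downset n (fun i => mu (n - i + 1)%N <= 0)) => j k jk kn muk.
by apply: le_trans muk; apply: mu_anti; lia.
Qed.

Hypothesis mu_last : mu n = -1.

Lemma mu_ge i : (1 <= i <= n)%N -> -1 <= mu (n - i + 1)%N.
Proof. by move=> iin; rewrite -mu_last; apply: mu_anti; lia. Qed.

Lemma leq_mIdx i : (1 <= i <= n)%N -> (i <= mIdx n mu)%N = (mu (n - i + 1)%N == -1).
Proof.
apply: (@bigmax_downset n (fun i => mu (n - i + 1)%N == -1)) => j k jk kn /eqP muk.
rewrite eq_le mu_ge ?andbT; last by lia.
by rewrite -muk; apply: mu_anti; lia.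
Qed.

End MuIndices.

Section Combinatorics.
Variables (n : nat) (lam : nat -> nat) (mu : nat -> int).
Hypothesis lam_step : forall j, (1 <= j < n)%N -> (lam j.+1 <= lam j)%N.
Hypothesis mu_step : forall j, (1 <= j < n)%N -> mu j.+1 <= mu j.
Hypothesis sum0 : \sum_(1 <= j < n.+1) ((lam j)%:Z + mu j) = 0.

Lemma lam_anti j k : (1 <= j <= k)%N -> (k <= n)%N -> (lam k <= lam j)%N.
Proof.
elim: k => [|k IH] jk kn; first by lia.
have [->//|ne] := eqVneq j k.+1.
by apply: leq_trans (IH _ _); [apply: lam_step|..]; lia.
Qed.

Local Notation b j := ((lam j)%:Z + mu j).

Lemma b_anti j k : (1 <= j <= k)%N -> (k <= n)%N -> b k <= b j.
Proof. by move=> jk kn; rewrite lerD ?lez_nat ?lam_anti ?(mu_anti mu_step). Qed.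

(* [lam + mu] is weakly decreasing with total sum zero, so its tail sums are nonpositive. *)
Lemma acoefZ_ge0 i : (i <= n)%N -> 0 <= acoefZ n lam mu i.
Proof.
move=> iin; rewrite /acoefZ oppr_ge0; set h := (n - i)%N.
have hn : (h <= n)%N by rewrite leq_subr.
have [h0|hgt0] := posnP h; first by rewrite h0 sum0.
move: sum0; rewrite (big_cat_nat (n := h.+1)) //= => /eqP; rewrite addr_eq0 => /eqP tE.
have [bh|bh] := leP 0 (b h).
  rewrite -oppr_ge0 -tE big_nat sumr_ge0 // => j jin.
  by apply: le_trans bh _; apply: b_anti; lia.
rewrite big_nat sumr_le0 // => j jin.
by apply: le_trans (ltW bh); apply: b_anti; lia.
Qed.

(** The cut-off in [acoef] is harmless: [acoefZ] is an empty sum at [i = 0] and minus the vanishing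
    total at [i = n]. *)
Lemma acoefE i : (i <= n)%N -> (acoef n lam mu i)%:Z = acoefZ n lam mu i.
Proof.
move=> iin; rewrite /acoef; case: ifP => [_|/negP ni]; first by rewrite gez0_abs ?acoefZ_ge0.
have [->|->] : i = 0%N \/ i = n by lia.
  by rewrite /acoefZ subn0 big_geq ?oppr0.
by rewrite /acoefZ subnn sum0 oppr0.
Qed.

Lemma acoef_step i : (1 <= i <= n)%N ->
  (acoef n lam mu i)%:Z - (acoef n lam mu i.-1)%:Z = - b (n - i + 1)%N.
Proof.
move=> iin; rewrite !acoefE /acoefZ; try lia.
rewrite big_ltn; last by lia.
have -> : ((n - i.-1).+1 = (n - i).+2)%N by lia.
by rewrite addn1 opprK opprD subrK.
Qed.

(** Since [lam] decreases, the rows counted by [colheight] form an initial segment; this is the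
    duality with the conjugate partition. *)
Lemma ltn_colheight h s : (h < n)%N -> (h < colheight n lam s)%N = (s <= lam h.+1)%N.
Proof.
move=> hn; rewrite /colheight; apply/idP/idP => [|sh].
  apply: contraTT; rewrite -ltnNge -leqNgt => hs.
  have -> : n = (h + (n - h))%N by lia.
  rewrite iotaD count_cat [X in (_ + X)%N](_ : _ = 0%N).
    by rewrite addn0 (leq_trans (count_size _ _)) // size_iota.
  apply/eqP; rewrite -leqn0 leqNgt -has_count; apply/hasPn => j.
  rewrite mem_iota -ltnNge => jin; apply: leq_ltn_trans hs; apply: lam_anti; lia.
have -> : n = (h.+1 + (n - h.+1))%N by lia.
rewrite iotaD count_cat ltn_addr // ltnNge; apply/negP.
have -> : count (fun j => (s <= lam j)%N) (iota 1 h.+1) = h.+1; last by lia.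
rewrite -[RHS](size_iota 1); apply/eqP; rewrite -all_count; apply/allP => j.
by rewrite mem_iota => jin; apply: leq_trans sh _; apply: lam_anti; lia.
Qed.

Lemma idx_lt i s : (1 <= i <= n)%N -> (idx n lam s < i)%N = (s <= lam (n - i + 1))%N.
Proof.
move=> iin; rewrite addn1 -ltn_colheight; last by lia.
by rewrite /idx; apply/idP/idP; lia.
Qed.

Lemma count_idx_lt i : (1 <= i <= n)%N ->
  \sum_(s <- iota 1 (lam 1%N) | (idx n lam s < i)%N) (1 : int) = (lam (n - i + 1))%:Z.
Proof.
move=> iin; set L := lam (n - i + 1)%N.
have LN : (L <= lam 1%N)%N by apply: lam_anti; lia.
have -> : lam 1%N = (L + (lam 1%N - L))%N by lia.
rewrite iotaD big_cat /= [X in _ + X]big_seq_cond [X in _ + X]big_pred0 ?addr0.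
  rewrite big_seq_cond (eq_bigl (fun s => s \in iota 1 L)).
    by rewrite -big_seq big_const_seq count_predT size_iota iter_addr_0 natz.
  by move=> s; rewrite mem_iota idx_lt // -/L; apply/andP/idP => [[]//|]; lia.
by move=> s; rewrite mem_iota idx_lt // -/L; apply/negP; lia.
Qed.

Variables (x : nat -> CC) (A : unitAlgType CC) (p : nat -> nat -> A).

(** The step of [acoef] contributes minus [lam + mu] at [n - i + 1], and the factors [Z_k] with
    [k < i] restore [lam]. *)
Lemma ldeg_gD_mu i : (1 <= i <= n)%N ->
  ldeg (gD n lam mu x p i) = - mu (n - i + 1)%N.
Proof.
move=> iin; rewrite ldeg_gD acoef_step // sum_idx_lt count_idx_lt //; lia.
Qed.

Hypothesis mu_last : mu n = -1.

Lemma ldeg_gD_eq1 i : (1 <= i <= n)%N ->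
  (ldeg (gD n lam mu x p i) == 1) = (i <= mIdx n mu)%N.
Proof. by move=> iin; rewrite ldeg_gD_mu // (leq_mIdx mu_step) // eqr_oppLR. Qed.

Lemma ldeg_gD_ge0 i : (1 <= i <= n)%N ->
  (0 <= ldeg (gD n lam mu x p i)) = (i <= mIdx' n mu)%N.
Proof. by move=> iin; rewrite ldeg_gD_mu // (leq_mIdx' mu_step) // oppr_ge0. Qed.

Lemma ldeg_gD_le1 i : (1 <= i <= n)%N -> ldeg (gD n lam mu x p i) <= 1.
Proof. by move=> iin; rewrite ldeg_gD_mu // lerNl (mu_ge mu_step mu_last). Qed.

End Combinatorics.

(** [S] is the bicommutant of the [p]'s. It contains them because they commute with each other, and
    the scalars because these are central; being closed under inverses, it keeps the differences of
    the [p]'s invertible. *)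
Lemma commutative_model (a : nat -> nat) (x : nat -> CC) (A : unitAlgType CC)
    (p : nat -> nat -> A) :
  (forall i r j s, r \in iota 1 (a i) -> s \in iota 1 (a j) ->
     p i r * p j s = p j s * p i r) ->
  (forall i r s, r \in iota 1 (a i) -> s \in iota 1 (a i) -> r != s ->
     p i r - p i s \is a GRing.unit) ->
  exists (S : comUnitRingType) (v : {rmorphism S -> A}) (ph : nat -> nat -> S)
         (xh : nat -> S),
    [/\ forall i r, r \in iota 1 (a i) -> v (ph i r) = p i r,
        forall s, v (xh s) = (x s)%:A
      & forall j, {in iota 1 (a j) &, forall r s, r != s ->
          ph j r - ph j s \is a GRing.unit}].
Proof.
move=> p_comm p_unit; pose G y := exists i r, r \in iota 1 (a i) /\ y = p i r.
pose S := bicommutant G; pose ph i r : S := insubd (0 : S) (p i r).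
have valph i r : r \in iota 1 (a i) -> val (ph i r) = p i r.
  move=> rin; rewrite insubdK //; apply: mem_bicomm; last by exists i, r.
  by move=> _ _ [j [s [js ->]]] [j' [s' [js' ->]]]; apply: p_comm.
exists S, (val : {rmorphism S -> A}), ph, (fun s => insubd (0 : S) (x s)%:A).
split=> [//|s|j r s rin sin nrs].
  rewrite /= insubdK //; apply/bicommP.
  by split=> y _; rewrite /GRing.comm mulr_algl mulr_algr.
have u : val (ph j r - ph j s) \is a GRing.unit.
  by rewrite [val _]rmorphB /= !valph // p_unit.
have uin : (val (ph j r - ph j s))^-1 \in bicomm G by rewrite rpredV; apply: valP.
apply/unitrP; exists (Bicommutant uin).
by split; apply: val_inj; rewrite [LHS]rmorphM [RHS]rmorph1; [apply: mulVr|apply: mulrV].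
Qed.

(** * Assembly of the matrix entries from rows, columns and diagonal *)

Unset Implicit Arguments.

Theorem theorem2p34 :
  forall (n : nat) (lam : nat -> nat) (mu : nat -> int) (x : nat -> CC)
         (A : unitAlgType CC) (p eqp eqm : nat -> nat -> A),
  (* standing assumption *)
  (2 <= n)%N ->
  (* lam : Young diagram with n rows, lam_n = 0 *)
  (forall j, (1 <= j < n)%N -> (lam j.+1 <= lam j)%N) ->
  lam n = 0%N ->
  (* mu : weakly decreasing integers, mu_n = -1 *)
  (forall j, (1 <= j < n)%N -> mu j.+1 <= mu j) ->
  mu n = -1 ->
  (* |lam| + |mu| = 0 *)
  \sum_(1 <= j < n.+1) ((lam j)%:Z + mu j) = 0 ->
  (* defining relations of the algebra (generators p_{i,r}, e^{+-q_{i,r}}, *)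
  (* 1 <= i < n, 1 <= r <= a_i)                                            *)
  let ok i r := (0 < i < n)%N && (0 < r <= acoef n lam mu i)%N in
  (forall i r j s, ok i r -> ok j s -> p i r * p j s = p j s * p i r) ->
  (forall i r j s, ok i r -> ok j s ->
     [/\ eqp i r * eqp j s = eqp j s * eqp i r,
         eqp i r * eqm j s = eqm j s * eqp i r &
         eqm i r * eqm j s = eqm j s * eqm i r]) ->
  (forall i r, ok i r -> eqp i r * eqm i r = 1 /\ eqm i r * eqp i r = 1) ->
  (forall i r j s, ok i r -> ok j s ->
     eqp i r * p j s - p j s * eqp i r = - ((i == j) && (r == s))%:R * eqp i r) ->
  (forall i r j s, ok i r -> ok j s ->
     eqm i r * p j s - p j s * eqm i r = ((i == j) && (r == s))%:R * eqm i r) ->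
  (forall i r s (k : int), ok i r -> ok i s -> r != s ->
     (p i r - p i s + k%:~R) \is a GRing.unit) ->
  let m := mIdx n mu in
  let m' := mIdx' n mu in
  let T := TD n lam mu x p eqp eqm in
  (* (a) *)
  [/\ (forall i, (1 <= i <= m)%N ->
         lser_eq (T i i) (ladd lz (lconst (Tdiag n lam mu x p i)))),
      (forall i, (m < i <= m')%N -> lser_eq (T i i) (lconst 1)),
      (forall i, (m' < i <= n)%N -> lser_eq (T i i) (lconst 0)),
      (forall i j, (m < i)%N -> (i < j <= n)%N ->
         lser_eq (T i j) (lconst 0) /\ lser_eq (T j i) (lconst 0))
    & (forall i j, (1 <= i <= m)%N -> (i < j <= n)%N ->
         lser_eq (T i j) (lconst (Tup n lam mu x p eqp i j))
         /\ lser_eq (T j i) (lconst (Tlow n lam mu p eqm j i)))]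
  (* (b) T_D(z) is a polynomial of degree 1 with z-coefficient sum_{i<=m} E_ii *)
  /\ (forall i j, (1 <= i <= n)%N -> (1 <= j <= n)%N ->
         (forall k : int, (k < 0 \/ 1 < k) -> lcoef (T i j) k = 0)
         /\ lcoef (T i j) 1 = ((i == j) && (i <= m)%N)%:R).

Proof.
move=> n lam mu x A p eqp eqm n2 lam_step _ mu_step mu_last sum0 ok p_comm e_comm e_inv
  eqp_p eqm_p p_unit m m' T.
have lev_ok' i r : r \in iota 1 (acoef n lam mu i) -> ok i r by rewrite lev_ok.
have [||S [v [ph [xh [v_ph v_xh ph_unit]]]]] := @commutative_model (acoef n lam mu) x A p.
- by move=> i r j s /lev_ok' ? /lev_ok' ?; apply: p_comm.
- move=> i r s /lev_ok' ir /lev_ok' js rs.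
  by have := p_unit i r s 0 ir js rs; rewrite mulr0z addr0.
have d1 i : (1 <= i <= n)%N -> ldeg (gD n lam mu x p i) <= 1.
  exact: ldeg_gD_le1.
have row i j : (1 <= i)%N -> (i < j <= n)%N -> lser_eq (T i j)
    (lconst (if (i <= m)%N then Tup n lam mu x p eqp i j else 0)).
  move=> i0 ij; rewrite -(ldeg_gD_eq1 lam_step mu_step sum0 x p mu_last); last by lia.
  apply: (TD_row e_comm e_inv eqp_p eqm_p v_ph v_xh ph_unit) => [//|l lin|]; last by lia.
  by apply: d1; lia.
have col i j : (1 <= i)%N -> (i < j <= n)%N -> lser_eq (T j i)
    (lconst (if (i <= m)%N then Tlow n lam mu p eqm j i else 0)).
  move=> i0 ij; rewrite -(ldeg_gD_eq1 lam_step mu_step sum0 x p mu_last); last by lia.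
  apply: (TD_col e_comm e_inv eqp_p eqm_p v_ph v_xh ph_unit) => [//|l lin|]; last by lia.
  by apply: d1; lia.
have m_le_n : (m <= n)%N.
  by apply/bigmax_leqP_seq => i; rewrite mem_index_iota; lia.
have m'_le_n : (m' <= n)%N.
  by apply/bigmax_leqP_seq => i; rewrite mem_index_iota; lia.
have diag1 i : (1 <= i <= m)%N ->
    lser_eq (T i i) (ladd lz (lconst (Tdiag n lam mu x p i))).
  move=> im; have i_n : (1 <= i <= n)%N by lia.
  rewrite -lcf1_gD_Tdiag.
  apply: (TD_diag1 e_comm e_inv eqp_p eqm_p v_ph v_xh ph_unit) => [|l lin|].
  - by lia.
  - by apply: d1; lia.
  by apply/eqP; rewrite (ldeg_gD_eq1 lam_step mu_step sum0) //; lia.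
have diag0 : forall i, (m < i <= n)%N ->
    lser_eq (T i i) (lconst (if (i <= m')%N then 1 else 0)).
  move=> i im; have i_n : (1 <= i <= n)%N by lia.
  have := d1 i i_n; rewrite le_eqVlt (ldeg_gD_eq1 lam_step mu_step sum0) //.
  rewrite leqNgt (_ : (mIdx n mu < i)%N) ?orFb; last by lia.
  move=> lt1; have di : ldeg (gD n lam mu x p i) <= 0 by move: lt1; set d := ldeg _; lia.
  rewrite -(ldeg_gD_ge0 lam_step mu_step sum0 x p) //.
  have -> : (0 <= ldeg (gD n lam mu x p i)) = (ldeg (gD n lam mu x p i) == 0).
    by rewrite eq_le di.
  apply: (TD_diag0 e_comm e_inv eqp_p eqm_p v_ph v_xh ph_unit) => [|l lin|//].
  - by lia.
  by apply: d1; lia.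
(* Needed so that [m' < i] implies [m < i], which lets [diag0] cover the zero diagonal entries. *)
have m_m' : (m <= m')%N.
  have [->//|m0] := posnP m; have m_n : (1 <= m <= n)%N by lia.
  rewrite (leq_mIdx' mu_step) //.
  by have := leq_mIdx mu_step mu_last m_n; rewrite leqnn => /esym/eqP ->.
split; first split.
- exact: diag1.
- by move=> i im; have := diag0 i; rewrite (_ : (i <= m')%N) => [d|]; [apply: d|]; lia.
- move=> i im; have := diag0 i; rewrite [(i <= m')%N]leqNgt.
  by rewrite (_ : (m' < i)%N) => [d|]; [apply: d|]; lia.
- move=> i j im ij; have := row i j; have := col i j.
  by rewrite [(i <= m)%N]leqNgt im => c r; split; [apply: r | apply: c]; lia.
- move=> i j im ij; have := row i j; have := col i j.
  by rewrite (_ : (i <= m)%N) => [c r|]; [split; [apply: r | apply: c] |]; lia.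
have const1 (c : A) (k : int) : k < 0 \/ 1 < k -> lcoef (lconst c) k = 0.
  by move=> kk; rewrite lcoef_lconst; case: eqP => // k0; lia.
(* For (b), every entry other than the diagonal ones with [i <= m] is a constant series. *)
have const_case i j (c : A) : ~~ ((i == j) && (i <= m)%N) -> lser_eq (T i j) (lconst c) ->
    (forall k : int, (k < 0 \/ 1 < k) -> lcoef (T i j) k = 0)
    /\ lcoef (T i j) 1 = ((i == j) && (i <= m)%N)%:R.
  move=> /negbTE-> Tc; split=> [k kk|]; first by rewrite Tc const1.
  by rewrite Tc lcoef_lconst.
move=> i j i_n j_n.
have [ij|[ji|<-]] : (i < j)%N \/ (j < i)%N \/ i = j by lia.
- by apply: (const_case _ _ _ _ (row i j _ _)); rewrite ?ltn_eqF //; lia.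
- by apply: (const_case _ _ _ _ (col j i _ _)); rewrite ?gtn_eqF //; lia.
have [im|mi] : (i <= m)%N \/ (m < i)%N by lia.
2:{ by apply: (const_case _ _ _ _ (diag0 i _)); rewrite ?eqxx -?ltnNge //; lia. }
have Ti : lser_eq (T i i) _ := diag1 i ltac:(lia).
rewrite eqxx im; split=> [k kk|]; rewrite Ti lcoef_ladd lcoef_lz.
  by rewrite const1 // addr0; case: eqP kk => // ->; lia.
by rewrite lcoef_lconst addr0.
Qed.
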